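(* Let $G=(V,E,w)$ be an undirected graph with $n$ vertices, $m$ edges and positive real edge weights, with edge weight ratio $\rho$. Then the weight of a minimum weight cycle of $G$ can be computed using $2\cdot\log n\cdot\log\rho$ calls to an APSD algorithm on undirected graphs with $2n$ vertices, at most $2m$ edges and edge weight ratio at most $\rho$, where each of these reduced graphs is constructed in $O(n+m)$ time, plus $O(n^2\cdot\log n\cdot\log(n\rho))$ additional processing time. Moreover, in these reduced graphs edge weights are preserved: every edge of a reduced graph has the weight of its corresponding edge of $G$. Hence MWC $\lesssim^{sprs}_{n^2}$ APSD (for weighted undirected graphs).
   Context: The edge weight ratio of a weighted graph is $\rho=M/m_{\min}$, where $M$ and $m_{\min}$ are the largest and smallest edge weights. MWC (minimum weight cycle): given a graph, compute the weight of a minimum weight (simple) cycle. APSD (all pairs shortest distances): given a graph, compute the shortest path distance between every pair of vertices. Sparse reductions: for graph problems $P,Q$, we write $P\lesssim^{sprs}_{f(m,n)} Q$ if, given an algorithm for $Q$ running in time $T_Q(m,n)$ on graphs with $n$ vertices and $m$ edges, one can solve $P$ on graphs with $n$ vertices and $m$ edges in time $\tilde O(T_Q(m,n)+f(m,n))$, making polylogarithmically many oracle calls to $Q$ on graphs with $\tilde O(n)$ vertices and $\tilde O(m)$ edges; here $\tilde O$ hides polylogarithmic factors, and for weighted graphs may additionally include a $\log\rho$ factor. *)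

(* Defs.v *)
From HB Require Import structures.
From mathcomp Require Import all_boot all_order all_algebra.
From mathcomp Require Import all_classical all_reals all_analysis.
Set Implicit Arguments.
Unset Strict Implicit.
Unset Printing Implicit Defensive.
Import Order.TTheory GRing.Theory Num.Theory.
Local Open Scope classical_set_scope.
Local Open Scope ring_scope.

(** * Weighted undirected graphs *)

(* ((u, v), w) is the undirected edge {u, v} of weight w. *)
Definition wedge (R : realType) : Type := (nat * nat * R)%type.

Definition joins (R : realType) (e : wedge R) (u v : nat) : bool :=
  (e.1 == (u, v)) || (e.1 == (v, u)).

(* No loops, no parallel edges (in either orientation), positive weights. *)
Definition simple_wgraph (R : realType) (g : nat * seq (wedge R)) : bool :=
  all (fun e : wedge R =>
         [&& (e.1.1 < g.1)%N, (e.1.2 < g.1)%N, e.1.1 != e.1.2 & 0 < e.2]) g.2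
  && pairwise (fun e f : wedge R => ~~ joins e f.1.1 f.1.2) g.2.

(* A graph with vertex set {0, ..., n - 1}, given by its edge list; the order
   of the list and the orientation of its entries play no role in any of the
   graph-theoretic notions below. *)
Record wgraph (R : realType) := WGraph {
  wgraph_val : (nat * seq (nat * nat * R))%type;
  wgraph_simple : simple_wgraph wgraph_val
}.

HB.instance Definition _ (R : realType) := [isSub for @wgraph_val R].
HB.instance Definition _ (R : realType) := [Choice of wgraph R by <:].

Definition nv (R : realType) (G : wgraph R) : nat := (wgraph_val G).1.
Definition edges (R : realType) (G : wgraph R) : seq (wedge R) :=
  (wgraph_val G).2.
Definition ne (R : realType) (G : wgraph R) : nat := size (edges G).

Definition adj (R : realType) (G : wgraph R) : rel nat :=
  fun u v => has (fun e => joins e u v) (edges G).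

(* At most one term, as there are no parallel edges. *)
Definition wt (R : realType) (G : wgraph R) (u v : nat) : R :=
  \sum_(e <- edges G | joins e u v) e.2.

Definition max_weight (R : realType) (G : wgraph R) : R :=
  \big[Num.max/0]_(e <- edges G) e.2.
Definition min_weight (R : realType) (G : wgraph R) : R :=
  \big[Num.min/max_weight G]_(e <- edges G) e.2.

(* Equal to 0 (= 0 / 0) on a graph without edges, where it is undefined. *)
Definition edge_ratio (R : realType) (G : wgraph R) : R :=
  max_weight G / min_weight G.

Fixpoint walk_wt (R : realType) (G : wgraph R) (u : nat) (p : seq nat) : R :=
  if p is v :: q then wt G u v + walk_wt G v q else 0.

Definition dist (R : realType) (G : wgraph R) (u v : nat) : \bar R :=
  ereal_inf [set (walk_wt G u p)%:E | p in
    [set p : seq nat | path (adj G) u p /\ last u p = v]].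

Definition simple_cycle (R : realType) (G : wgraph R) (c : seq nat) : Prop :=
  [/\ (2 < size c)%N, uniq c & cycle (adj G) c].

Definition cycle_wt (R : realType) (G : wgraph R) (c : seq nat) : R :=
  if c is u :: p then walk_wt G u (rcons p u) else 0.

Definition mwc (R : realType) (G : wgraph R) : \bar R :=
  ereal_inf [set (cycle_wt G c)%:E | c in [set c | simple_cycle G c]].

(** * Graph problems *)

Definition problem (R : realType) : Type := wgraph R -> seq R.

(* Weights and distances are nonnegative; -1 stands for an infinite value. *)
Definition enc (R : realType) (x : \bar R) : R :=
  if x is r%:E then r else -1.

Definition MWC (R : realType) : problem R := fun G => [:: enc (mwc G)].

(* The distance matrix, row by row. *)
Definition APSD (R : realType) : problem R := fun G =>
  [seq enc (dist G u v) | u <- iota 0 (nv G), v <- iota 0 (nv G)].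

(** * Oracle real RAM

   The memory consists of finitely many (for a given program) integer arrays
   and real arrays.  Integers are machine words: evaluation is stuck as soon as
   an integer exceeds [W].  Reals support exact arithmetic and comparison, but
   no rounding and no conversion to integers.  Expressions occurring in a
   program have constant size, so that executing an assignment or a test is
   charged one unit of time. *)

Inductive iop := IAdd | ISub | IMul | IDiv | IMod.
Inductive rop := RAdd | RSub | RMul | RDiv.

Inductive iexp :=
  | IConst of nat
  | IGet of nat & iexp
  | IOp of iop & iexp & iexp.

Inductive rexp :=
  | RConst of nat
  | RGet of nat & iexp
  | ROp of rop & rexp & rexp.

Inductive bexp :=
  | BILt of iexp & iexp
  | BRLt of rexp & rexp
  | BNot of bexp
  | BAnd of bexp & bexp.

(* [Query c] runs [c] to construct a graph in the query area, then calls the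
   oracle on this graph. *)
Inductive cmd :=
  | Skip
  | IPut of nat & iexp & iexp
  | RPut of nat & iexp & rexp
  | Seq of cmd & cmd
  | If of bexp & cmd & cmd
  | While of bexp & cmd
  | Query of cmd.

Record state (R : realType) := State {
  ints : nat -> nat -> nat;
  reals : nat -> nat -> R
}.

Definition upd (T : Type) (f : nat -> nat -> T) (a k : nat) (x : T) :
    nat -> nat -> T :=
  fun b l => if (b == a) && (l == k) then x else f b l.

Definition word (W k : nat) : option nat := if (k <= W)%N then Some k else None.

Definition iop_sem (o : iop) : nat -> nat -> nat :=
  match o with
  | IAdd => addn | ISub => subn | IMul => muln | IDiv => divn | IMod => modn
  end.

Definition rop_sem (R : realType) (o : rop) (x y : R) : option R :=
  match o with
  | RAdd => Some (x + y)
  | RSub => Some (x - y)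
  | RMul => Some (x * y)
  | RDiv => if y == 0 then None else Some (x / y)
  end.

Fixpoint ieval (R : realType) (W : nat) (s : state R) (e : iexp) : option nat :=
  match e with
  | IConst k => word W k
  | IGet a i => obind (fun k => word W (ints s a k)) (ieval W s i)
  | IOp o e1 e2 =>
      obind (fun x => obind (fun y => word W (iop_sem o x y)) (ieval W s e2))
        (ieval W s e1)
  end.

Fixpoint reval (R : realType) (W : nat) (s : state R) (e : rexp) : option R :=
  match e with
  | RConst k => Some k%:R
  | RGet a i => omap (reals s a) (ieval W s i)
  | ROp o e1 e2 =>
      obind (fun x => obind (rop_sem o x) (reval W s e2)) (reval W s e1)
  end.

Fixpoint beval (R : realType) (W : nat) (s : state R) (b : bexp) : option bool :=
  match b with
  | BILt e1 e2 =>
      obind (fun x => omap (fun y => (x < y)%N) (ieval W s e2)) (ieval W s e1)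
  | BRLt e1 e2 =>
      obind (fun x => omap (fun y => x < y) (reval W s e2)) (reval W s e1)
  | BNot b1 => omap negb (beval W s b1)
  | BAnd b1 b2 =>
      obind (fun x => omap (andb x) (beval W s b2)) (beval W s b1)
  end.

(* Memory layout: the input graph is in integer arrays 0, 1, 2 and real array
   0, the query graph in integer arrays 3, 4, 5 and real array 1, the answer of
   the oracle in real array 2 and the final output in real array 3. *)

Definition input_state (R : realType) (G : wgraph R) : state R :=
  State
    (fun a k => match a with
                | 0%N => nth 0%N [:: nv G; ne G] k
                | 1%N => nth 0%N [seq e.1.1 | e <- edges G] k
                | 2%N => nth 0%N [seq e.1.2 | e <- edges G] k
                | _ => 0%N
                end)
    (fun a k => if a is 0%N then nth 0 [seq e.2 | e <- edges G] k else 0).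

Definition clear_query (R : realType) (s : state R) : state R :=
  State (fun a k => if a \in [:: 3; 4; 5]%N then 0%N else ints s a k)
        (fun a k => if a == 1%N then 0 else reals s a k).

Definition query_graph (R : realType) (s : state R) (H : wgraph R) : Prop :=
  [/\ ints s 3 0 = nv H, ints s 3 1 = ne H &
      forall k, (k < ne H)%N ->
        nth (0%N, 0%N, 0) (edges H) k = (ints s 4 k, ints s 5 k, reals s 1 k)].

Definition write_answer (R : realType) (s : state R) (ans : seq R) : state R :=
  State (ints s)
    (fun a k => if (a == 2)%N then nth (reals s a k) ans k else reals s a k).

Definition outputs (R : realType) (s : state R) (out : seq R) : Prop :=
  forall k, (k < size out)%N -> reals s 3 k = nth 0 out k.

(* [exec W Q c s s' t tr]: with word bound [W] and an oracle for [Q], command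
   [c] leads from [s] to [s'].  The trace [tr] lists the calls to the oracle:
   for each of them, the time spent to construct the query graph (starting from
   an empty query area) and this graph.  The time spent outside these
   constructions, and outside the oracle, is [t]. *)
Inductive exec (R : realType) (W : nat) (Q : problem R) :
    cmd -> state R -> state R -> nat -> seq (nat * wgraph R) -> Prop :=
  | ESkip s : exec W Q Skip s s 1 [::]
  | EIPut a i e s k x :
      ieval W s i = Some k -> ieval W s e = Some x ->
      exec W Q (IPut a i e) s (State (upd (ints s) a k x) (reals s)) 1 [::]
  | ERPut a i e s k x :
      ieval W s i = Some k -> reval W s e = Some x ->
      exec W Q (RPut a i e) s (State (ints s) (upd (reals s) a k x)) 1 [::]
  | ESeq c1 c2 s s1 s2 t1 t2 tr1 tr2 :
      exec W Q c1 s s1 t1 tr1 -> exec W Q c2 s1 s2 t2 tr2 ->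
      exec W Q (Seq c1 c2) s s2 (t1 + t2)%N (tr1 ++ tr2)
  | EIf b c1 c2 s s' v t tr :
      beval W s b = Some v ->
      exec W Q (if v then c1 else c2) s s' t tr ->
      exec W Q (If b c1 c2) s s' t.+1 tr
  | EWhile b c s s' t tr :
      exec W Q (If b (Seq c (While b c)) Skip) s s' t tr ->
      exec W Q (While b c) s s' t tr
  | EQuery c s s1 t H :
      exec W Q c (clear_query s) s1 t [::] -> query_graph s1 H ->
      exec W Q (Query c) s (write_answer s1 (Q H)) 1 [:: (t, H)].

(* Words of O(log n) bits. *)
Definition word_bound (R : realType) (K : nat) (G : wgraph R) : nat :=
  ((nv G).+2 ^ K)%N.

(** * Reductions *)

Definition log2 (R : realType) (x : R) : R := ln x / ln 2.

(* [H] is one of the reduced graphs of [G]: its vertices are two copies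
   [v] and [n + v] of each vertex [v] of [G], and each of its edges lies over
   an edge of [G] of the same weight. *)
Definition reduced_graph (R : realType) (G H : wgraph R) : Prop :=
  [/\ nv H = (2 * nv G)%N, (ne H <= 2 * ne G)%N, edge_ratio H <= edge_ratio G &
      forall e, e \in edges H -> exists2 f, f \in edges G &
        joins f (e.1.1 %% nv G)%N (e.1.2 %% nv G)%N /\ f.2 = e.2].

Definition polylog (c n : nat) : nat := (c * (up_log 2 n).+1 ^ c)%N.

(* Running-time bounds [T m n] for which it makes sense to hide polylogarithmic
   factors in the size of the oracle calls: T(Õ(m), Õ(n)) = Õ(T(m, n)). *)
Definition time_bound (R : realType) (T : nat -> nat -> R) : Prop :=
  (forall m n, 1 <= T m n) /\
  (forall c, exists c', forall m n m' n',
     (m' <= polylog c n * m)%N -> (n' <= polylog c n * n)%N ->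
     T m' n' <= (polylog c' n)%:R * T m n).

(* [P] reduces to [Q] by a sparse reduction with overhead [f m n]; a call to
   the oracle on a graph with n' vertices and m' edges is charged T(m', n'). *)
Definition sparse_reduction (R : realType) (f : nat -> nat -> R)
    (P Q : problem R) : Prop :=
  exists (p : cmd) (c : nat), forall T : nat -> nat -> R, time_bound T ->
  exists C : nat, forall G : wgraph R, exists s t tr,
    [/\ exec (word_bound c G) Q p (input_state G) s t tr,
        outputs s (P G),
        (size tr)%:R <= (polylog c (nv G))%:R * (1 + log2 (edge_ratio G)),
        (forall tH, tH \in tr ->
           (nv tH.2 <= polylog c (nv G) * nv G)%N /\
           (ne tH.2 <= polylog c (nv G) * ne G)%N) &
        t%:R + \sum_(tH <- tr) (tH.1%:R + T (ne tH.2) (nv tH.2))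
          <= (polylog C (nv G))%:R * (1 + log2 (edge_ratio G))
             * (T (ne G) (nv G) + f (ne G) (nv G))].

(* Main.v *)
Require Import Defs.
From mathcomp Require Import all_boot all_order all_algebra.
From mathcomp Require Import all_classical all_reals all_analysis.
From mathcomp Require Import zify ring lra.
Set Implicit Arguments.
Unset Strict Implicit.
Unset Printing Implicit Defensive.
Import Order.TTheory GRing.Theory Num.Theory.
Local Open Scope ring_scope.

(** A minimum weight cycle is recognised from distances alone.  Fix a vertex [z],
    two neighbours [u <> v] of [z] and a vertex [y] such that
    [d(y,u) + w(u,z) < d(y,z) + 2 w(u,z)], and the same for [v]: then no shortest walk
    from [y] to [u] (to [v]) uses the edge [uz] ([vz]), so the closed walk
    [y - u - z - v - y] contains a simple cycle.  Conversely, in a minimum weight cycle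
    through [y] let [z] and [v] be the ends of the edge containing the point antipodal
    to [y], [z] being the one farther from [y], and let [u] be the other neighbour of
    [z] on the cycle; the two arcs from [y] to [z] then meet these inequalities.

    The distances [d(y,u) + w(u,z)] come from a graph with two copies of each vertex:
    all edges in the first copy, plus some arcs from [u] to the second copy of [z].
    Restricting these arcs to the edges with weight in [(th/2, th]] turns the
    inequality into the test [D <= d(y,z) + th], and restricting them by a bit that
    differs for the edges [uz] and [vz] ensures [u <> v].  To keep at most [m] arcs per
    graph, the bits are those of a label of the ordered pair [(z,u)] whose bits are all
    complemented when [z] and [u] are exchanged. *)

(** * Walks and cycles *)

Section Walks.
Variables (R : realType) (G : wgraph R).
Implicit Types (u v x y z : nat) (p q c : seq nat).

Lemma edges_ok e : e \in edges G ->
  [/\ (e.1.1 < nv G)%N, (e.1.2 < nv G)%N, e.1.1 != e.1.2 & 0 < e.2].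
Proof.
move=> eG; have /andP[/allP/(_ e eG) /and4P[] // _ _] := wgraph_simple G.
Qed.

Lemma joinsC (e : wedge R) u v : joins e u v = joins e v u.
Proof. by rewrite /joins orbC. Qed.

Lemma adj_sym : symmetric (adj G).
Proof. by move=> u v; apply: eq_has => e; exact: joinsC. Qed.

Lemma adj_bound u v : adj G u v -> [/\ (u < nv G)%N, (v < nv G)%N & u != v].
Proof.
case/hasP => -[[a b] w] /edges_ok /= [? ? ab _].
by case/orP => /eqP[<- <-]; rewrite // eq_sym.
Qed.

(** Parallel edges are excluded, so the sum defining [wt] has a single term. *)
Lemma wt_joins (e : wedge R) u v : e \in edges G -> joins e u v -> wt G u v = e.2.
Proof.
have /andP[_] := wgraph_simple G; rewrite /wt -/(edges G).
elim: (edges G) => // f s IH /= /andP[fs ps]; rewrite inE big_cons => /orP[/eqP ->|es] euv.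
  rewrite euv big_seq_cond big1 ?addr0 // => g /andP[gs guv].
  have /allP/(_ g gs) := fs; rewrite /joins.
  by move: euv guv; rewrite /joins => /orP[] /eqP -> /orP[] /eqP -> /=; rewrite eqxx ?orbT.
rewrite IH //; case: ifP => // fuv; have /allP/(_ e es) := fs; rewrite /joins.
by move: euv fuv; rewrite /joins => /orP[] /eqP -> /orP[] /eqP -> /=; rewrite eqxx ?orbT.
Qed.

Lemma wtC u v : wt G u v = wt G v u.
Proof. by apply: eq_bigl => e; exact: joinsC. Qed.

Lemma wt_ge0 u v : 0 <= wt G u v.
Proof.
rewrite /wt big_seq_cond; apply: sumr_ge0 => e /andP[/edges_ok[_ _ _]].
by move/ltW.
Qed.

Lemma wt_gt0 u v : adj G u v -> 0 < wt G u v.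
Proof.
case/hasP => e eG euv; rewrite (wt_joins eG euv).
by case: (edges_ok eG).
Qed.

Lemma walk_wt_ge0 u p : 0 <= walk_wt G u p.
Proof. by elim: p u => //= v p IH u; rewrite addr_ge0 ?wt_ge0. Qed.

Lemma walk_wt_cat u p q :
  walk_wt G u (p ++ q) = walk_wt G u p + walk_wt G (last u p) q.
Proof. by elim: p u => [|v p IH] u /=; rewrite ?add0r // IH addrA. Qed.

Lemma walk_wt_rcons u p v :
  walk_wt G u (rcons p v) = walk_wt G u p + wt G (last u p) v.
Proof. by rewrite -cats1 walk_wt_cat /= addr0. Qed.

Lemma walk_wt_gt0 u p : path (adj G) u p -> p != [::] -> 0 < walk_wt G u p.
Proof.
case: p => //= v p /andP[uv _] _.
by rewrite ltr_wpDr ?walk_wt_ge0 ?wt_gt0.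
Qed.

Lemma walk_wt_rev u p :
  walk_wt G (last u p) (rev (belast u p)) = walk_wt G u p.
Proof.
elim: p u => //= v p IH u; rewrite rev_cons walk_wt_rcons IH wtC addrC.
by case: p {IH} => // a p; rewrite [belast _ _]/= rev_cons last_rcons.
Qed.

Lemma path_rev u p :
  path (adj G) u p -> path (adj G) (last u p) (rev (belast u p)).
Proof. by rewrite rev_path => up; rewrite (eq_path (e' := adj G)) // => a b; exact: adj_sym. Qed.

Lemma last_rev_belast u p : last (last u p) (rev (belast u p)) = u.
Proof. by case: p => //= a p; rewrite rev_cons last_rcons. Qed.

Lemma path_bound u p : path (adj G) u p -> all (fun v => v < nv G)%N p.
Proof.
elim: p u => //= v p IH u /andP[/adj_bound[_ -> _] /IH].
by [].
Qed.

(** Loops are cut out at repeated vertices, which cannot increase the weight since weights are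
    nonnegative. The relation [e] is arbitrary because the lemma also serves for walks that must
    avoid a given edge. *)
Lemma walk_uniq (e : rel nat) u p : path e u p ->
  exists q, [/\ path e u q, uniq (u :: q), last u q = last u p &
    walk_wt G u q <= walk_wt G u p].
Proof.
elim: p u => [|v p IH] u; first by move=> _; exists [::].
case/andP=> uv /IH[q [vq uq lq wq]].
have [|uNq] := boolP (u \in v :: q); last first.
  by exists (v :: q); split; rewrite ?lerD2l //= ?uv ?uNq.
have wle : walk_wt G u (v :: q) <= walk_wt G u (v :: p) by rewrite lerD2l.
move=> uin; have [q1 [q2 E]] : exists q1 q2, v :: q = q1 ++ u :: q2.
  by case/splitPr: uin => a b; exists a, b.
exists q2; have eq : path e u (v :: q) by rewrite /= uv.
have := uq; have := lq; have := wle; have := eq; rewrite -[last v q]/(last u (v :: q)) E.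
rewrite cat_path last_cat walk_wt_cat cat_uniq /= => /andP[_ /andP[_ ->]] le -> /and3P[_ _ ->].
split=> //; apply: le_trans le; rewrite addrA lerDr addr_ge0 ?walk_wt_ge0 ?wt_ge0 //.
Qed.

(** Shortcutting keeps the edge [ab] forbidden, so the resulting simple path from [a] to [b] has at
    least two edges and closes up with [ab] to a cycle of at least three vertices. *)
Lemma cycle_of_walk a b p : adj G a b ->
  path (fun x y => adj G x y && ~~ (((x, y) == (a, b)) || ((x, y) == (b, a)))) a p ->
  last a p = b ->
  exists c, simple_cycle G c /\ cycle_wt G c <= walk_wt G a p + wt G a b.
Proof.
move=> ab /walk_uniq[q [aq uq lq wq]] lp; rewrite lp in lq.
have aqG : path (adj G) a q by apply: sub_path aq => x y /andP[].
exists (a :: q); split; last first.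
  by rewrite /= walk_wt_rcons lq (wtC b) lerD2r.
split => //; last by rewrite /= rcons_path aqG lq adj_sym.
have [_ _ neq] := adj_bound ab.
case: q aq lq {wq aqG uq} => [|x [|? ?]] //=; first by move=> _ E; rewrite E eqxx in neq.
by move=> /andP[/andP[_ +] _] E; rewrite E eqxx.
Qed.

(** The walk along [p], back along [q] to [v] and then to [z] joins [u] to [z] without the edge
    [uz]: it meets [z] only at its end, coming from [v], and [v] differs from [u]. *)
Lemma cycle_of_two_walks z u v p q : adj G u z -> adj G v z -> u != v ->
  path (adj G) u p -> z \notin p -> path (adj G) v q -> z \notin q ->
  last u p = last v q ->
  exists c, simple_cycle G c /\
    cycle_wt G c <= walk_wt G u p + wt G u z + (walk_wt G v q + wt G v z).
Proof.
move=> uz vz uv up zp vq zq E.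
have [_ _ uNz] := adj_bound uz; have [_ _ vNz] := adj_bound vz.
have avoid x r : x != z -> z \notin r -> path (adj G) x r ->
    path (fun x y => adj G x y && ~~ (((x, y) == (u, z)) || ((x, y) == (z, u)))) x r.
  elim: r x => //= a r IH x xz; rewrite inE negb_or => /andP[za zr] /andP[xa ar].
  rewrite eq_sym in za.
  by rewrite xa IH // !xpair_eqE (negPf xz) (negPf za) andbF.
have [] := @cycle_of_walk u z (p ++ rcons (rev (belast v q)) z) uz.
- rewrite cat_path avoid //= rcons_path E last_rev_belast vz avoid ?path_rev //.
  + by rewrite !xpair_eqE (negPf vNz) eqxx andbT orbF eq_sym.
  + rewrite -E; case: (lastP p) zp {E up} => // s x.
    by rewrite mem_rcons inE negb_or last_rcons eq_sym => /andP[].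
  + rewrite mem_rev; apply/negP => /mem_belast; rewrite inE eq_sym (negPf vNz) /=.
    exact/negP.
- by rewrite last_cat last_rcons.
move=> c [cc cw]; exists c; split=> //; apply: le_trans cw _.
rewrite walk_wt_cat walk_wt_rcons E last_rev_belast walk_wt_rev; lra.
Qed.

(** After removal of the common prefix the paths leave some vertex through different neighbours and
    never return to it; that vertex takes the place of [z] in [cycle_of_two_walks]. *)
Lemma cycle_of_two_paths y p q : path (adj G) y p -> uniq (y :: p) ->
  path (adj G) y q -> uniq (y :: q) -> last y p = last y q -> p != q ->
  exists c, simple_cycle G c /\ cycle_wt G c <= walk_wt G y p + walk_wt G y q.
Proof.
have nilu x s : uniq (x :: s) -> last x s = x -> s = [::].
  by case/lastP: s => // s a; rewrite last_rcons /= mem_rcons inE => + E; rewrite E eqxx.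
elim: p y q => [|a p IH] y [|b q] //= yp up yq uq E.
- by have := nilu y (b :: q) uq (esym E).
- by have := nilu y (a :: p) up E.
case/andP: yp => ya ap; case/andP: yq => yb bq.
move: up uq => /andP[+ up] /andP[+ uq]; rewrite !inE !negb_or => /andP[yNa yp] /andP[yNb yq].
have [eab|ab _] := eqVneq a b.
  rewrite -{b}eab in bq yb yNb E uq *.
  rewrite eqseq_cons eqxx /= => pq.
  have [c [cc cw]] := IH a q ap up bq uq E pq; exists c; split=> //.
  by apply: le_trans cw _; have := wt_ge0 y a; lra.
have [||c [cc cw]] := @cycle_of_two_walks y a b p q _ _ ab ap yp bq yq E; rewrite 1?adj_sym //.
by exists c; split=> //; move: cw; rewrite (wtC a) (wtC b); lra.
Qed.

(** A lighter walk would shorten to a different simple path with the same ends, and the two paths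
    together would contain a cycle lighter than [W]. *)
Lemma shortest_half_cycle W y p : (forall c, simple_cycle G c -> W <= cycle_wt G c) ->
  path (adj G) y p -> uniq (y :: p) -> 2 * walk_wt G y p <= W ->
  forall q, path (adj G) y q -> last y q = last y p -> walk_wt G y p <= walk_wt G y q.
Proof.
move=> Wmin yp up le q yq lq.
have [r [yr ur lr wr]] := walk_uniq yq.
apply: le_trans wr; have [->//|neq] := eqVneq p r.
have lpr : last y p = last y r by rewrite lr lq.
have [c [cc cw]] := cycle_of_two_paths yp up yr ur lpr neq.
have := Wmin c cc; lra.
Qed.

(** The edge from [last y p] to [b] is the one containing the point at distance [h] along the
    walk. *)
Lemma split_walk y r h : 0 <= h < walk_wt G y r ->
  exists p b q, r = p ++ b :: q /\ walk_wt G y p <= h < walk_wt G y p + wt G (last y p) b.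
Proof.
elim: r y h => [|b r IH] y h /=; first by move=> /andP[] /le_lt_trans H /H; rewrite ltxx.
move=> /andP[h0 hlt]; have [lt|le] := ltP h (wt G y b).
  by exists [::], b, r; split=> //=; rewrite h0 add0r.
have [|p [c [q [-> H]]]] := IH b (h - wt G y b); first lra.
by exists (b :: p), c, q; split=> //=; lra.
Qed.

(* The edge of the cycle that contains the point antipodal to [y] joins [z] to
   its predecessor [v] on the far side; [u] is the predecessor on the near side. *)
Lemma critical_edge c : simple_cycle G c ->
  (forall c', simple_cycle G c' -> cycle_wt G c <= cycle_wt G c') ->
  exists y z u v p q,
    [/\ [/\ (y < nv G)%N, adj G u z, adj G v z & u != v],
        [/\ path (adj G) y p, last y p = u, path (adj G) y q & last y q = v],
        walk_wt G y p + wt G u z + (walk_wt G y q + wt G v z) = cycle_wt G c,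
        forall r, path (adj G) y r -> last y r = z ->
          walk_wt G y p + wt G u z <= walk_wt G y r &
        walk_wt G y q <= walk_wt G y p + wt G u z].
Proof.
case: c => [|y p]; first by case.
set W := cycle_wt _ _ => -[sz up /= yp] Wmin.
have W0 : 0 < W by apply: walk_wt_gt0 => //; case: (p).
have ur : uniq (rcons p y) by rewrite rcons_uniq.
have [|p1 [b [p2 [E /andP[le lt]]]]] := @split_walk y (rcons p y) (W / 2).
  by rewrite -/(cycle_wt G (y :: p)) -/W; lra.
have lp2 : last b p2 = y by have := congr1 (last y) E; rewrite last_rcons last_cat.
have yn : (y < nv G)%N.
  by move: yp; rewrite rcons_path => /andP[_ /adj_bound[]].
move: yp ur; rewrite E cat_path cat_uniq => /andP[yp1 /= /andP[ab bp2]] /and3P[up1 disj ubp2].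
have WE : W = walk_wt G y p1 + (wt G (last y p1) b + walk_wt G b p2).
  by rewrite /W /cycle_wt E walk_wt_cat.
have disj' x : x \in p1 -> x \in b :: p2 -> False.
  by move=> x1 x2; case/negP: disj; apply/(@hasP _ (mem p1) (b :: p2)); exists x.
(* Each end of this edge is within [W / 2] of [y] along the arc that avoids the edge, so that arc is
   a shortest walk. The end for which this arc is the longer one becomes [z]; a tie goes to [b]. *)
have [fle|gt] := lerP (walk_wt G y p1) (walk_wt G b p2).
  (* An empty [p2] means [b = y]; the arc from [b] then has weight 0, which forces [p1] to be empty
     and the cycle to have a single vertex. *)
  case: p2 E lp2 bp2 ubp2 WE fle {disj} disj' => [|u p2].
    move=> E lp2 _ _ _ /= fle _; move: E; case: p1 yp1 fle {ab le lt up1} => [|a p1] yp1.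
      by move=> _ /(congr1 size); rewrite size_rcons; case: (p) sz.
    by rewrite leNgt walk_wt_gt0.
  move=> E lp2 bp2 ubp2 WE fle disj'; set p0 := rev (belast u p2).
  have lp0 : last y p0 = u by rewrite -[y](lp2 : last u p2 = y) last_rev_belast.
  have s_def : rcons p0 b = rev (belast b (u :: p2)) by rewrite /= rev_cons.
  have ws : walk_wt G y (rcons p0 b) = walk_wt G b (u :: p2).
    by rewrite s_def -lp2 walk_wt_rev.
  have ys : path (adj G) y (rcons p0 b) by rewrite s_def -lp2 path_rev.
  have ubE : walk_wt G y p0 + wt G u b = walk_wt G b (u :: p2).
    by rewrite -ws walk_wt_rcons lp0.
  exists y, b, u, (last y p1), p0, p1; split.
  - split=> //; first by move: bp2 => /= /andP[]; rewrite adj_sym.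
    case/lastP: p1 E disj' {ab yp1 le lt up1 WE fle} => [|p1 x] E disj' /=; last first.
      rewrite last_rcons; apply/eqP => ux; apply: (disj' x); first by rewrite mem_rcons inE eqxx.
      by rewrite -ux !inE eqxx orbT.
    (* Here [p1] is empty, so [v = y]; if also [u = y], uniqueness leaves only the two vertices [y]
       and [b] on the cycle. *)
    apply/eqP => uy; case: p2 E lp2 ubp2 {bp2 disj' p0 lp0 s_def ws ys ubE} => [E _ _|x p2 _ lp2].
      by have := congr1 size E; rewrite size_rcons; move: sz => /=; lia.
    by rewrite /= => /and3P[_ + _]; rewrite uy -(lp2 : last x p2 = y) mem_last.
  - by split=> //; move: ys; rewrite rcons_path => /andP[].
  - by rewrite WE ubE; lra.
  - move=> r yr lr; rewrite ubE -ws; apply: shortest_half_cycle Wmin _ _ _ _ yr _ => //.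
    + rewrite s_def -{1}lp2 -rev_rcons -lastI rev_uniq.
      by [].
    + by rewrite ws; move: WE => /=; lra.
    + by rewrite last_rcons.
  - by rewrite ubE.
case/lastP: p1 E yp1 up1 ab disj disj' WE le lt gt => [|p1 a] E yp1 up1 ab disj disj' WE le lt gt.
  by move: gt; rewrite ltNge walk_wt_ge0.
rewrite last_rcons in ab lt WE.
move: (yp1); rewrite rcons_path => /andP[yp1' ua].
have wr : walk_wt G y (rev (belast b p2)) = walk_wt G b p2 by rewrite -lp2 walk_wt_rev.
exists y, a, (last y p1), b, p1, (rev (belast b p2)); split.
- split=> //; first by rewrite adj_sym.
  case: p1 E disj' {yp1 up1 disj WE le lt gt yp1' ua} => [|x p1] E disj' /=.
    apply/eqP => yb; case: p2 E lp2 ubp2 {bp2 disj' wr} => [E _ _|x p2 _ lp2].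
      by have := congr1 size E; rewrite size_rcons; move: sz => /=; lia.
    by rewrite /= -yb -(lp2 : last x p2 = y) mem_last.
  apply/eqP => lb; apply: (disj' b); last by rewrite inE eqxx.
  by rewrite -lb rcons_cons -rcons_cons mem_rcons inE mem_last orbT.
- split=> //; first by rewrite -lp2 path_rev.
  by rewrite -lp2 last_rev_belast.
- rewrite wr (wtC b) WE walk_wt_rcons; lra.
- move=> r yr lr; rewrite -walk_wt_rcons; apply: shortest_half_cycle Wmin _ _ _ _ yr _ => //.
  + rewrite /= up1 andbT; apply/negP => yin; apply: (disj' y) => //.
    by rewrite -lp2 mem_last.
  + by rewrite -/(cycle_wt _ _) -/W; lra.
  + by rewrite last_rcons.
- by rewrite wr -walk_wt_rcons ltW.
Qed.

Lemma split_last_visit z y p : z \in y :: p ->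
  exists r s, [/\ p = r ++ s, last y r = z & z \notin s].
Proof.
elim: p y => [|a p IH] y; first by rewrite inE => /eqP ->; exists [::], [::].
have [/IH[r [s [-> lr zs]]] _|zap] := boolP (z \in a :: p); first by exists (a :: r), s.
by rewrite inE (negPf zap) orbF => /eqP zy; exists [::], (a :: p).
Qed.

(** After its last visit to [z] the walk reaches [u] with weight less than [wt G u z]. Hence it
    leaves [z] through a neighbour other than [u], and this last part closes up with the edge
    [uz]. *)
Lemma cycle_of_return y z u p : adj G u z -> path (adj G) y p -> last y p = u ->
  (forall r, path (adj G) y r -> last y r = z ->
     walk_wt G y p + wt G u z < walk_wt G y r + 2 * wt G u z) ->
  z \in y :: p ->
  exists c, simple_cycle G c /\ cycle_wt G c <= walk_wt G y p + wt G u z.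
Proof.
move=> uz yp lp far /split_last_visit[r [s [E lr zs]]].
have [_ _ uNz] := adj_bound uz.
move: yp lp; rewrite E cat_path last_cat lr => /andP[yr rs] ls.
have := far r yr lr; rewrite E walk_wt_cat lr.
have := walk_wt_ge0 y r.
case: s {E} zs rs ls => [|x s] /= zs; first by move=> _ zu; rewrite zu eqxx in uNz.
case/andP=> zx xs ls r0 lt; have := zs; rewrite inE negb_or => /andP[_ zNs].
have [xu|xNu] := eqVneq x u.
  by move: lt; rewrite xu (wtC z) => lt; have := walk_wt_ge0 u s; lra.
have [||c [cc cw]] := @cycle_of_two_walks z u x [::] s uz _ _ isT isT xs zNs (esym ls).
- by rewrite adj_sym.
- by rewrite eq_sym.
by exists c; split=> //; move: cw; rewrite /= (wtC x); lra.
Qed.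

(** A walk that visits [z] yields a cycle on its own by [cycle_of_return]. Otherwise the reversed
    walks from [u] and [v] to [y] avoid [z], and [cycle_of_two_walks] applies. *)
Lemma cycle_of_detours y z u v p q : adj G u z -> adj G v z -> u != v ->
  path (adj G) y p -> last y p = u -> path (adj G) y q -> last y q = v ->
  (forall r, path (adj G) y r -> last y r = z ->
     walk_wt G y p + wt G u z < walk_wt G y r + 2 * wt G u z) ->
  (forall r, path (adj G) y r -> last y r = z ->
     walk_wt G y q + wt G v z < walk_wt G y r + 2 * wt G v z) ->
  exists c, simple_cycle G c /\
    cycle_wt G c <= walk_wt G y p + wt G u z + (walk_wt G y q + wt G v z).
Proof.
move=> uz vz uv yp lp yq lq farp farq.
have p0 := walk_wt_ge0 y p; have q0 := walk_wt_ge0 y q.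
have u0 := wt_ge0 u z; have v0 := wt_ge0 v z.
have [zp|zp] := boolP (z \in y :: p).
  have [c [cc cw]] := cycle_of_return uz yp lp farp zp.
  by exists c; split=> //; lra.
have [zq|zq] := boolP (z \in y :: q).
  have [c [cc cw]] := cycle_of_return vz yq lq farq zq.
  by exists c; split=> //; lra.
have notin s : z \notin y :: s -> z \notin rev (belast y s).
  by rewrite mem_rev; apply: contra; exact: mem_belast.
have [|||c [cc cw]] := @cycle_of_two_walks z u v (rev (belast y p)) (rev (belast y q)) uz vz uv
    _ (notin _ zp) _ (notin _ zq).
- by rewrite -lp path_rev.
- by rewrite -lq path_rev.
- by rewrite -{1}lp -{1}lq !last_rev_belast.
by exists c; split=> //; move: cw; rewrite -{1}lp -{1}lq !walk_wt_rev.
Qed.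

Lemma uniq_size_bound p : all (fun v => v < nv G)%N p -> uniq p -> (size p <= nv G)%N.
Proof.
move=> /allP lt up; rewrite -(size_iota 0 (nv G)); apply: uniq_leq_size => // x /lt.
by rewrite mem_iota.
Qed.
End Walks.

(** * Attainment of distances and of the minimum cycle weight *)

Fixpoint words (n k : nat) : seq (seq nat) :=
  if k is k'.+1 then [::] :: [seq x :: p | x <- iota 0 n, p <- words n k'] else [:: [::]].

Lemma mem_words n k p : (size p <= k)%N -> all (fun v => v < n)%N p -> p \in words n k.
Proof.
elim: k p => [|k IH] [|x p] //= sp /andP[xn pn]; rewrite inE.
by apply/allpairsPdep; exists x, p; rewrite mem_iota xn IH.
Qed.

Lemma seq_argmin (R : realType) (T : eqType) (P : T -> Prop) (f : T -> R) (s : seq T) :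
  (exists2 x, x \in s & P x) ->
  exists x, [/\ x \in s, P x & forall y, y \in s -> P y -> f x <= f y].
Proof.
elim: s => [|a s IH] [x]; first by [].
have [[b bs Pb]|nos] := pselect (exists2 x, x \in s & P x).
  have [|c [cs Pc cmin]] := IH; first by exists b.
  move=> _ _; have [Pa|nPa] := pselect (P a); last first.
    exists c; split=> // [|y]; first by rewrite inE cs orbT.
    by rewrite inE => /orP[/eqP -> //|]; exact: cmin.
  have [le|lt] := leP (f a) (f c).
    exists a; split=> // [|y]; first by rewrite inE eqxx.
    by rewrite inE => /orP[/eqP -> //|ys] /(cmin _ ys); exact: le_trans.
  exists c; split=> // [|y]; first by rewrite inE cs orbT.
  by rewrite inE => /orP[/eqP -> _|]; [exact: ltW|exact: cmin].
rewrite inE => /orP[/eqP -> Pa|xs Px]; last by case: nos; exists x.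
exists a; split=> // [|y]; first by rewrite inE eqxx.
by rewrite inE => /orP[/eqP -> //|ys Py]; case: nos; exists y.
Qed.

Lemma ereal_inf_min (R : realType) (T : Type) (A : set T) (f : T -> R) x :
  A x -> (forall y, A y -> f x <= f y) ->
  ereal_inf [set (f y)%:E | y in A]%classic = (f x)%:E.
Proof.
move=> Ax xmin; apply/eqP; rewrite eq_le; apply/andP; split.
  by apply: ereal_inf_lbound; exists x.
by apply: le_ereal_inf_tmp => _ [y Ay <-]; rewrite lee_fin xmin.
Qed.

Section Optima.
Variables (R : realType) (G : wgraph R).

(** The infimum ranges over infinitely many walks, but each can be shortened to a simple path, and
    these lie in the finite list [words (nv G) (nv G)]. The second alternative is the encoding of
    infinity. *)
Lemma enc_distP u v :
  (exists p, [/\ path (adj G) u p, last u p = v, enc (dist G u v) = walk_wt G u p &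
     forall q, path (adj G) u q -> last u q = v -> walk_wt G u p <= walk_wt G u q])
  \/ (enc (dist G u v) = -1 /\ forall p, path (adj G) u p -> last u p <> v).
Proof.
pose P p := path (adj G) u p /\ last u p = v.
have red q : P q -> exists2 r, r \in words (nv G) (nv G) & P r /\ walk_wt G u r <= walk_wt G u q.
  case=> uq lq; have [r [ur uniqr lr wr]] := walk_uniq G uq.
  exists r; last by split=> //; split=> //; rewrite lr.
  have rn := path_bound ur.
  by apply: mem_words => //; apply: uniq_size_bound rn _; case/andP: uniqr.
have [[q Pq]|none] := pselect (exists q, P q); last first.
  right; split; last by move=> p up lp; apply: none; exists p.
  rewrite /dist (_ : [set _ | _ in _]%classic = set0) ?ereal_inf0 //.
  by apply/seteqP; split=> // x [p Pp _]; case: none; exists p.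
left; have [|p [_ [up lp] pmin]] := @seq_argmin R _ P (walk_wt G u) (words (nv G) (nv G)).
  by have [r rw [Pr _]] := red q Pq; exists r.
have le r : P r -> walk_wt G u p <= walk_wt G u r.
  by move=> /red[s sw [Ps]]; apply: le_trans; exact: pmin.
exists p; split=> //; last by move=> r ur lr; exact: le.
by rewrite /dist (@ereal_inf_min R _ _ (walk_wt G u) p).
Qed.

Lemma enc_mwcP :
  (exists c, [/\ simple_cycle G c, enc (mwc G) = cycle_wt G c &
     forall c', simple_cycle G c' -> cycle_wt G c <= cycle_wt G c'])
  \/ (enc (mwc G) = -1 /\ forall c, ~ simple_cycle G c).
Proof.
have [[c0 c0P]|none] := pselect (exists c, simple_cycle G c); last first.
  right; split; last by move=> c cP; apply: none; exists c.
  rewrite /mwc (_ : [set _ | _ in _]%classic = set0) ?ereal_inf0 //.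
  by apply/seteqP; split=> // x [c Pc _]; case: none; exists c.
have inw c : simple_cycle G c -> c \in words (nv G) (nv G).
  case=> _ uc cc; have cn : all (fun v => v < nv G)%N c.
    by apply/allP => x /(next_cycle cc) /adj_bound[].
  by apply: mem_words => //; exact: uniq_size_bound cn uc.
left; have [|c [_ cP cmin]] := @seq_argmin R _ (simple_cycle G) (cycle_wt G) (words (nv G) (nv G)).
  by exists c0; first exact: inw.
exists c; split=> //; last by move=> c' cP'; apply: cmin (inw _ cP') cP'.
by rewrite /mwc (@ereal_inf_min R _ _ (cycle_wt G) c) // => c' cP'; apply: cmin (inw _ cP') cP'.
Qed.
End Optima.

(** * Reduced graphs *)

(* Labels of the ordered pairs of distinct vertices below [N]: for fixed [z]
   they are distinct, and if [N = 2 ^ L] then exchanging [z] and [u] complements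
   all [L] bits.  Thus every bit orients each edge, opposite bits give opposite
   orientations, and two edges at [z] have different orientations for some bit. *)
Definition code (N z u : nat) : nat := ((u + N.+1 - z) %% N.+1 - 1)%N.

Definition codebit (N b z u : nat) : nat := ((code N z u %/ b) %% 2)%N.

Lemma codeE N z u : (u <= N)%N -> (z <= N)%N -> u != z ->
  code N z u = if (z < u)%N then (u - z - 1)%N else (N - (z - u))%N.
Proof.
move=> uN zN uz; rewrite /code; case: ltnP => zu.
  have -> : (u + N.+1 - z = u - z + N.+1)%N by lia.
  by rewrite modnDr modn_small; lia.
by rewrite modn_small; lia.
Qed.

Lemma code_complement N z u : (u < N)%N -> (z < N)%N -> u != z ->
  code N u z = (N - 1 - code N z u)%N.
Proof. by move=> uN zN uz; rewrite !codeE; try lia; do 2 case: ltnP => ?; lia. Qed.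

Lemma code_lt N z u : (u < N)%N -> (z < N)%N -> u != z -> (code N z u < N)%N.
Proof. by move=> uN zN uz; rewrite codeE; try lia; case: (ltnP z u) => ?; lia. Qed.

Lemma code_inj N z u v : (u < N)%N -> (v < N)%N -> (z < N)%N ->
  u != z -> v != z -> code N z u = code N z v -> u = v.
Proof. by move=> uN vN zN uz vz; rewrite !codeE; try lia; do 2 case: ltnP => ?; lia. Qed.

Lemma divn_exp2S a i : (a %/ 2 ^ i.+1 = a %/ 2 %/ 2 ^ i)%N.
Proof. by rewrite expnS divnMA. Qed.

Lemma bits_inj L a b : (a < 2 ^ L)%N -> (b < 2 ^ L)%N ->
  (forall i, (i < L)%N -> a %/ 2 ^ i = b %/ 2 ^ i %[mod 2]) -> a = b.
Proof.
elim: L a b => [|L IH] a b; first by rewrite expn0; case: a b => [|?] [|?].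
rewrite expnS => aL bL bits.
have /= := bits 0 isT; rewrite expn0 !divn1 => par.
have E : (a %/ 2 = b %/ 2)%N.
  apply: IH => [||i iL]; [lia|lia|].
  by rewrite -!divn_exp2S; exact: bits.
by rewrite (divn_eq a 2) (divn_eq b 2) E par.
Qed.

(** Subtraction from [2 ^ L - 1], all of whose bits are 1, involves no borrow and flips each bit. *)
Lemma bit_complement L i a : (a < 2 ^ L)%N -> (i < L)%N ->
  ((2 ^ L - 1 - a) %/ 2 ^ i %% 2 = 1 - a %/ 2 ^ i %% 2)%N.
Proof.
elim: i L a => [|i IH] [|L] a //; rewrite expnS => aL iL.
  by rewrite expn0 !divn1; lia.
rewrite !divn_exp2S.
have -> : ((2 * 2 ^ L - 1 - a) %/ 2 = 2 ^ L - 1 - a %/ 2)%N by lia.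
by apply: IH => //; lia.
Qed.

Lemma codebit_complement L i z u : (u < 2 ^ L)%N -> (z < 2 ^ L)%N -> u != z -> (i < L)%N ->
  codebit (2 ^ L) (2 ^ i) u z = (1 - codebit (2 ^ L) (2 ^ i) z u)%N.
Proof.
by move=> uN zN uz iL; rewrite /codebit code_complement // bit_complement // code_lt.
Qed.

Lemma codebit_separates L z u v : (u < 2 ^ L)%N -> (v < 2 ^ L)%N -> (z < 2 ^ L)%N ->
  u != z -> v != z -> u != v ->
  exists2 i, (i < L)%N & codebit (2 ^ L) (2 ^ i) z u != codebit (2 ^ L) (2 ^ i) z v.
Proof.
move=> uN vN zN uz vz uv; apply: contrapT => no; case/eqP: uv.
apply: (@code_inj (2 ^ L) z) => //; apply: (@bits_inj L); rewrite ?code_lt // => i iL.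
by apply/eqP; apply: contraPT no => ne; apply; exists i.
Qed.

(** * Extremal edge weights and the edge weight ratio *)

Section WeightRange.
Variables (R : realType) (G : wgraph R).

Lemma le_max_weight e : e \in edges G -> e.2 <= max_weight G.
Proof. by move=> eG; apply: le_bigmax_seq eG _. Qed.

Lemma ge_min_weight e : e \in edges G -> min_weight G <= e.2.
Proof. by move=> eG; apply: ge_bigmin_seq eG _. Qed.

Lemma max_weight_lub (x : R) : 0 <= x -> (forall e, e \in edges G -> e.2 <= x) ->
  max_weight G <= x.
Proof. by move=> x0 H; rewrite /max_weight big_seq; exact: bigmax_le. Qed.

(** The first hypothesis comes from [max_weight G] being the default value of the minimum. *)
Lemma min_weight_glb (x : R) : x <= max_weight G -> (forall e, e \in edges G -> x <= e.2) ->
  x <= min_weight G.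
Proof. by move=> xM H; rewrite /min_weight big_seq; exact: le_bigmin. Qed.

Lemma min_weight_attained : (0 < ne G)%N -> exists2 e, e \in edges G & e.2 = min_weight G.
Proof.
move=> m0; have [|e [eG _ emin]] := @seq_argmin R _ (fun _ => True) snd (edges G).
  by move: m0; rewrite /ne; case: (edges G) => // e s _; exists e; rewrite ?inE ?eqxx.
exists e => //; apply/eqP; rewrite eq_le ge_min_weight // min_weight_glb ?le_max_weight //.
by move=> f fG; exact: emin.
Qed.

Lemma min_weight_gt0 : (0 < ne G)%N -> 0 < min_weight G.
Proof. by move=> /min_weight_attained[e /edges_ok[_ _ _ ?] <-]. Qed.

Lemma edge_ratio_ge1 : (0 < ne G)%N -> 1 <= edge_ratio G.
Proof.
move=> m0; rewrite /edge_ratio ler_pdivlMr ?min_weight_gt0 // mul1r.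
by have [e eG <-] := min_weight_attained m0; exact: le_max_weight.
Qed.

End WeightRange.

(** * The reduced graph and its distances *)

Section ReducedGraph.
Variables (R : realType) (G : wgraph R) (N b j : nat) (th : R).
Notation n := (nv G).

(** Membership in the interval from [th / 2] (excluded) to [th] (included), in terms of the strict
    comparison that the machine offers. *)
Definition in_class (w : R) : bool := (th / 2 < w) && ~~ (th < w).

(** An arc into the second copy of [z] from [u] is wanted when the bit of the ordered pair [(z, u)]
    is [j]. With complementary labels this holds for exactly one orientation, so one arc per edge
    suffices. *)
Definition cross (e : wedge R) : wedge R :=
  if codebit N b e.1.2 e.1.1 == j then (e.1.1, n + e.1.2, e.2)%N
  else (e.1.2, n + e.1.1, e.2)%N.

Definition crossings (s : seq (wedge R)) : seq (wedge R) :=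
  [seq cross e | e <- s & in_class e.2].

Lemma crossE e : e \in edges G ->
  exists a c, [/\ cross e = (a, n + c, e.2)%N, (a < n)%N, (c < n)%N & joins e a c].
Proof.
case: e => -[a c] w /edges_ok /= [an cn _ _].
by rewrite /cross /=; case: ifP => _; [exists a, c|exists c, a]; rewrite /joins eqxx ?orbT.
Qed.

(** Base edges stay in the first copy while every arc ends in the second, so the two kinds never
    coincide; two arcs with the same ends would lie over the same pair of vertices of [G]. *)
Lemma reduced_simple : simple_wgraph ((2 * n)%N, edges G ++ crossings (edges G)).
Proof.
have /andP[_ pw] := wgraph_simple G; apply/andP; split=> /=.
  rewrite all_cat; apply/andP; split; apply/allP => -[[a c] w].
    move=> /edges_ok /= [? ? ? ?]; apply/and4P; split=> //; lia.
  case/mapP => f; rewrite mem_filter => /andP[_ fG].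
  have [a' [c' [-> an cn _]]] := crossE fG; have [_ _ _ w0] := edges_ok fG.
  case=> -> -> ->; apply/and4P; split=> //=; lia.
rewrite pairwise_cat pw /=; apply/andP; split.
  apply/allrelP => -[[x x'] w] f /edges_ok /= [? ? _ _] /mapP[g].
  rewrite mem_filter => /andP[_ /crossE[a [c [-> an cn _]]] ->] /=.
  rewrite /joins /= !xpair_eqE; lia.
rewrite /crossings pairwise_map; apply: pairwise_filter.
move: pw; apply: (sub_in_pairwise (P := mem (edges G))); last exact/allP.
move=> e f eG fG; apply: contra.
have [a [c [-> an cn eac]]] := crossE eG; have [a' [c' [-> an' cn' fac]]] := crossE fG.
rewrite /= /joins /= !xpair_eqE => H.
have [? ?] : a = a' /\ c = c' by lia.
subst a' c'; move: eac fac; rewrite /joins.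
by move=> /orP[] /eqP -> /orP[] /eqP -> /=; rewrite eqxx ?orbT.
Qed.

Definition reduced : wgraph R := WGraph reduced_simple.

Lemma mem_reduced e : e \in edges reduced ->
  e \in edges G \/ exists2 f, f \in edges G & in_class f.2 /\ e = cross f.
Proof.
rewrite mem_cat => /orP[->|/mapP[f]]; first by left.
by rewrite mem_filter => /andP[cf fG] ->; right; exists f.
Qed.

Lemma mod_copy a c : (a < n)%N -> (c < n)%N -> (((a %% n)%N = a) * (((n + c) %% n)%N = c))%type.
Proof. by move=> an cn; rewrite modnDl !modn_small. Qed.

Lemma reduced_over e : e \in edges reduced -> exists2 f, f \in edges G &
  joins f (e.1.1 %% n)%N (e.1.2 %% n)%N /\ f.2 = e.2.
Proof.
case/mem_reduced => [eG|[f fG [_ ->]]]; [exists e|exists f] => //.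
  have [an bn _ _] := edges_ok eG; rewrite !modn_small //; split=> //.
  by rewrite /joins -surjective_pairing eqxx.
have [a [c [-> an cn fac]]] := crossE fG.
by rewrite /= !(mod_copy an cn).
Qed.

Lemma reduced_weights : max_weight reduced = max_weight G /\ min_weight reduced = min_weight G.
Proof.
have GH e : e \in edges G -> e \in edges reduced by rewrite mem_cat => ->.
have M0 H : 0 <= max_weight H :> R by apply: bigmax_ge_id.
have EM : max_weight reduced = max_weight G.
  apply/eqP; rewrite eq_le; apply/andP; split.
    apply: max_weight_lub => // e /reduced_over[f fG [_ <-]]; exact: le_max_weight.
  by apply: max_weight_lub => // e /GH; exact: le_max_weight.
split=> //; apply/eqP; rewrite eq_le; apply/andP; split.
  apply: min_weight_glb => [|e /GH]; last exact: ge_min_weight.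
  by rewrite -EM; exact: bigmin_le_id.
apply: min_weight_glb => [|e /reduced_over[f fG [_ <-]]]; last exact: ge_min_weight.
by rewrite EM; exact: bigmin_le_id.
Qed.

Lemma reducedP : reduced_graph G reduced.
Proof.
split=> //; last exact: reduced_over.
  rewrite /ne /edges /= size_cat size_map size_filter.
  by rewrite mul2n -addnn leq_add2l count_size.
by rewrite /edge_ratio; case: reduced_weights => -> ->.
Qed.

Lemma adj_reduced_over u v : adj reduced u v ->
  adj G (u %% n)%N (v %% n)%N /\ wt reduced u v = wt G (u %% n)%N (v %% n)%N.
Proof.
case/hasP => e eH euv; have [f fG [fj fw]] := reduced_over eH.
have fuv : joins f (u %% n)%N (v %% n)%N.
  by move: euv fj; rewrite /joins => /orP[] /eqP -> //=; rewrite orbC.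
split; first by apply/hasP; exists f.
by rewrite (wt_joins eH euv) (wt_joins fG fuv) fw.
Qed.

Lemma adj_reduced_base u v : adj G u v -> adj reduced u v /\ wt reduced u v = wt G u v.
Proof.
case/hasP => e eG euv; have eH : e \in edges reduced by rewrite mem_cat eG.
split; first by apply/hasP; exists e.
by rewrite (wt_joins eH euv) (wt_joins eG euv).
Qed.

Lemma walk_reduced_over y p : path (adj reduced) y p ->
  path (adj G) (y %% n)%N [seq v %% n | v <- p]%N /\
  walk_wt reduced y p = walk_wt G (y %% n)%N [seq v %% n | v <- p]%N.
Proof.
elim: p y => //= v p IH y /andP[/adj_reduced_over[yv ->] /IH[vp ->]].
by rewrite yv vp.
Qed.

Lemma last_mod y p : (y < n)%N -> last y [seq v %% n | v <- p]%N = (last y p %% n)%N.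
Proof. by move=> yn; rewrite -{1}(modn_small yn); exact: (last_map (modn^~ n)). Qed.

Lemma walk_reduced_base y p : path (adj G) y p ->
  path (adj reduced) y p /\ walk_wt reduced y p = walk_wt G y p.
Proof.
elim: p y => //= v p IH y /andP[/adj_reduced_base[yv ->] /IH[vp ->]].
by rewrite yv vp.
Qed.

(** Every walk of [G] is a walk of the reduced graph, and reduction modulo [n] projects walks of the
    reduced graph to [G] with the same weight. Distances inside the first copy are therefore those
    of [G]. *)
Lemma enc_dist_reducedP y z : (y < n)%N -> (z < n)%N ->
  (exists p, [/\ path (adj G) y p, last y p = z, enc (dist reduced y z) = walk_wt G y p &
     forall q, path (adj G) y q -> last y q = z -> walk_wt G y p <= walk_wt G y q])
  \/ (enc (dist reduced y z) = -1 /\ forall p, path (adj G) y p -> last y p <> z).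
Proof.
move=> yn zn; case: (enc_distP reduced y z) => [[p [yp lp -> pmin]]|[-> none]]; [left|right].
  have [yp' wp] := walk_reduced_over yp; rewrite (modn_small yn) in yp' wp.
  exists [seq v %% n | v <- p]%N; split=> //.
    by rewrite last_mod // lp modn_small.
  by rewrite -wp => q /walk_reduced_base[yq <-]; exact: pmin.
by split=> // p /walk_reduced_base[yp _]; exact: none.
Qed.

Hypothesis complement : forall u v, (u < n)%N -> (v < n)%N -> u != v ->
  codebit N b v u = (1 - codebit N b u v)%N.
Hypothesis j_bit : (j < 2)%N.

(** In the second branch of [cross] the bit of the tested orientation is not [j]; complementarity
    and [j < 2] make the bit of the opposite orientation equal to [j]. *)
Lemma adj_reduced_crossP u z : (z < n)%N ->
  reflect [/\ adj G u z, in_class (wt G u z) & codebit N b z u = j] (adj reduced u (n + z)%N).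
Proof.
move=> zn; have bit2 a c : (codebit N b a c < 2)%N by rewrite ltn_mod.
apply: (iffP hasP) => [[e /mem_reduced[eG|[f fG [cf ->]]] euz]|[uz cuz bit]].
- have [en en' _ _] := edges_ok eG; move: euz en en'; rewrite /joins.
  by case/orP => /eqP -> /=; lia.
- case: f fG cf euz => -[a c] w fG cf euz; have [/= an cn ac _] := edges_ok fG.
  have [[-> [-> bj]]|[-> [-> bj]]] : (u = a /\ z = c /\ codebit N b c a = j) \/
      (u = c /\ z = a /\ codebit N b c a <> j).
    move: euz; rewrite /joins /cross /=.
    by case: (codebit N b c a =P j) => bj /orP[] /eqP[? ?]; [left|left|right|right]; split; try split; lia.
  + have fac : joins (a, c, w) a c by rewrite /joins eqxx.
    by split=> //; [apply/hasP; exists (a, c, w)|rewrite (wt_joins fG fac)].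
  + have fca : joins (a, c, w) c a by rewrite /joins eqxx orbT.
    split=> //; [by apply/hasP; exists (a, c, w)|by rewrite (wt_joins fG fca)|].
    by rewrite complement 1?eq_sym //; have := bit2 c a; lia.
- have [un _ uNz] := adj_bound uz; case/hasP: uz => f fG fuz.
  exists (cross f).
    rewrite mem_cat; apply/orP; right; apply: map_f; rewrite mem_filter fG andbT.
    by rewrite -(wt_joins fG fuz).
  move: fuz; rewrite /joins /cross => /orP[] /eqP ->; rewrite /= ?bit ?eqxx //=.
  rewrite complement 1?eq_sym // bit ifN ?eqxx ?orbT //; apply/eqP; lia.
Qed.

(** Dropping the last edge of a walk to [n + z] and projecting the rest gives a walk of [G], even if
    that rest passes through second copies. Conversely an arc can be appended to any walk of [G]
    that ends at its tail. *)
Lemma enc_dist_crossP y z : (y < n)%N -> (z < n)%N ->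
  (exists u p, [/\ path (adj G) y p, last y p = u,
     [/\ adj G u z, in_class (wt G u z) & codebit N b z u = j],
     enc (dist reduced y (n + z)%N) = walk_wt G y p + wt G u z &
     forall v q, path (adj G) y q -> last y q = v ->
       adj G v z -> in_class (wt G v z) -> codebit N b z v = j ->
       walk_wt G y p + wt G u z <= walk_wt G y q + wt G v z])
  \/ (enc (dist reduced y (n + z)%N) = -1 /\
     forall v q, path (adj G) y q -> last y q = v ->
       adj G v z -> in_class (wt G v z) -> codebit N b z v = j -> False).
Proof.
move=> yn zn.
have ext v q : path (adj G) y q -> last y q = v ->
    adj G v z -> in_class (wt G v z) -> codebit N b z v = j ->
    [/\ path (adj reduced) y (rcons q (n + z)%N), last y (rcons q (n + z)%N) = (n + z)%N &
        walk_wt reduced y (rcons q (n + z)%N) = walk_wt G y q + wt G v z].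
  move=> yq lq vz cvz bvz; have [yq' wq] := walk_reduced_base yq.
  have vnz : adj reduced v (n + z)%N by apply/adj_reduced_crossP.
  have [_ wv] := adj_reduced_over vnz; have [vn _ _] := adj_bound vz.
  by rewrite rcons_path lq yq' vnz last_rcons walk_wt_rcons lq wq wv !(mod_copy vn zn).
case: (enc_distP reduced y (n + z)%N) => [[p [yp lp -> pmin]]|[-> none]]; [left|right]; last first.
  by split=> // v q yq lq vz cvz bvz; have [yq' lq' _] := ext v q yq lq vz cvz bvz; exact: (none _ yq').
case/lastP: p yp lp pmin => [|p x]; first by move=> _ /= E; lia.
rewrite rcons_path last_rcons => /andP[yp px] xE pmin; subst x.
set u := last y p in px.
have [uz cuz buz] := elimT (adj_reduced_crossP _ zn) px.
have [un _ _] := adj_bound uz; have [_ wu] := adj_reduced_over px.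
have [yp' wp] := walk_reduced_over yp; rewrite (modn_small yn) in yp' wp.
have E : walk_wt reduced y (rcons p (n + z)%N) = walk_wt G y [seq v %% n | v <- p]%N + wt G u z.
  by rewrite walk_wt_rcons -/u wp wu !(mod_copy un zn).
exists u, [seq v %% n | v <- p]%N; split=> //.
  by rewrite last_mod // modn_small.
move=> v q yq lq vz cvz bvz; have [yq' lq' <-] := ext v q yq lq vz cvz bvz.
by rewrite -E; exact: pmin.
Qed.
End ReducedGraph.

(** * Minima of candidate sums *)

(** The value -1 means that no candidate has been found. Since [0 <= a] is demanded once a candidate
    exists, [a] is then a genuine minimum. *)
Definition is_min (R : realType) (P : R -> Prop) (a : R) : Prop :=
  (a = -1 \/ P a) /\ forall x, P x -> 0 <= a <= x.

(** This is [(a < 0) || (x < a)] written with the connectives of the machine. *)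
Definition improves (R : realType) (a x : R) : bool := ~~ (~~ (a < 0) && ~~ (x < a)).

(** Many candidates may be added at once by passing from [P] to [Q]: it is enough that [x], when
    accepted by the test [ok], is one of them and bounds all the new ones from below. *)
Lemma is_min_step (R : realType) (P Q : R -> Prop) (ok : bool) (a x : R) :
  is_min P a -> (forall r, P r -> Q r) -> (ok -> Q x /\ 0 <= x) ->
  (forall r, Q r -> P r \/ (ok /\ x <= r)) ->
  is_min Q (if ok && improves a x then x else a).
Proof.
move=> [aP amin] PQ okx QP; split.
  case: ifP => [/andP[/okx[]]|_]; first by right.
  by case: aP => [->|/PQ]; [left|right].
move=> r /QP[/amin/andP[a0 ar]|[ok1 xr]].
  case: ifP => [/andP[/okx[_ x0]]|_]; last by rewrite a0.
  by rewrite /improves -leNgt a0 /= negbK => /ltW xa; rewrite x0 (le_trans xa ar).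
have [_ x0] := okx ok1; rewrite ok1 /=; case: ifP => [_|]; first by rewrite x0.
by rewrite /improves => /negbFE /andP[]; rewrite -!leNgt => -> /le_trans ->.
Qed.

Section Candidates.
Variables (R : realType) (G : wgraph R) (L : nat).
Notation n := (nv G).

Definition threshold (k : nat) : R := max_weight G / 2 ^+ k.

(* By the last condition, the walk [p] never goes from [z] to [u] along their edge. *)
Definition candidate (i j K y z : nat) (x : R) : Prop := exists k u p,
  [/\ (k < K)%N, path (adj G) y p, last y p = u,
      [/\ adj G u z, in_class (threshold k) (wt G u z) & codebit (2 ^ L) (2 ^ i) z u = j] &
      x = walk_wt G y p + wt G u z /\
      forall r, path (adj G) y r -> last y r = z -> x <= walk_wt G y r + threshold k].

(** The first condition records loop progress: bits below [i] are finished, and for bit [i] the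
    pairs of index [y * n + z] below [t]. The two summands may come from different weight classes,
    so sums are formed only after all classes have been treated. *)
Definition pair_candidate (K i t : nat) (x : R) : Prop := exists h y z x0 x1,
  [/\ (h < i)%N \/ h = i /\ (y * n + z < t)%N, (y < n)%N /\ (z < n)%N,
      candidate h 0 K y z x0, candidate h 1 K y z x1 & x = x0 + x1].

Lemma thresholdS k : threshold k.+1 = threshold k / 2.
Proof. by rewrite /threshold exprS invfM; lra. Qed.

(** For a fixed bit and a fixed pair the two summands vary independently, so the least sum is the
    sum of the two minima. *)
Lemma is_min_pairS K i t (a0 a1 best : R) : (t < n * n)%N ->
  is_min (candidate i 0 K (t %/ n) (t %% n)) a0 ->
  is_min (candidate i 1 K (t %/ n) (t %% n)) a1 ->
  is_min (pair_candidate K i t) best ->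
  is_min (pair_candidate K i t.+1)
    (if (~~ (a0 < 0) && ~~ (a1 < 0)) && improves best (a0 + a1) then a0 + a1 else best).
Proof.
move=> tn a0min a1min bmin.
have n0 : (0 < n)%N by case: (n) tn.
have [yn zn] : (t %/ n < n)%N /\ (t %% n < n)%N by rewrite ltn_divLR // ltn_mod.
apply: is_min_step bmin _ _ _.
- move=> r [h [y [z [x0 [x1 [ht yz c0 c1 ->]]]]]]; exists h, y, z, x0, x1; split=> //.
  by case: ht => [?|[? ?]]; [left|right; split; lia].
- rewrite -!leNgt => /andP[a00 a10]; split; last exact: addr_ge0.
  exists i, (t %/ n)%N, (t %% n)%N, a0, a1; split=> //.
  + by right; rewrite -divn_eq.
  + by case: a0min => -[E|//]; rewrite E in a00; lra.
  + by case: a1min => -[E|//]; rewrite E in a10; lra.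
- move=> r [h [y [z [x0 [x1 [ht [yn' zn'] c0 c1 ->]]]]]].
  have [[hE E]|ht'] : (h = i /\ (y * n + z = t)%N) \/
      ((h < i)%N \/ h = i /\ (y * n + z < t)%N).
    by case: ht => [?|[? ?]]; [right; left|case: (ltnP (y * n + z) t) => ?; [right; right|left]; lia].
    have yE : y = (t %/ n)%N by rewrite -E divnMDl // divn_small // addn0.
    have zE : z = (t %% n)%N by rewrite -E modnMDl modn_small.
    subst h; rewrite {}yE {}zE in c0 c1; right; rewrite -!leNgt.
    have /andP[-> le0] := a0min.2 _ c0; have /andP[-> le1] := a1min.2 _ c1.
    by split=> //; exact: lerD.
  by left; exists h, y, z, x0, x1.
Qed.

Lemma is_min_eq (P Q : R -> Prop) a : (forall x, P x <-> Q x) -> is_min P a -> is_min Q a.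
Proof.
move=> PQ [aP amin]; split; last by move=> x /PQ; exact: amin.
by case: aP => [->|/PQ]; [left|right].
Qed.

Lemma is_min_pair_next K i (best : R) :
  is_min (pair_candidate K i (n * n)) best -> is_min (pair_candidate K i.+1 0) best.
Proof.
apply: is_min_eq => x; split=> -[h [y [z [x0 [x1 [ht [yn zn] c0 c1 ->]]]]]];
  exists h, y, z, x0, x1; split=> //.
  by left; lia.
have : (y * n + z < n * n)%N.
  by apply: (@leq_trans (y.+1 * n)); [rewrite mulSn addnC ltn_add2r|rewrite leq_mul2r yn orbT].
by case: ht => [?|[? ?]]; lia.
Qed.

Lemma in_class_exists K w : threshold K < w -> w <= max_weight G ->
  exists2 k, (k < K)%N & in_class (threshold k) w.
Proof.
elim: K => [|K IH] lt le; first by move: lt; rewrite /threshold expr0 divr1; lra.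
have [/IH[//|k kK ck]|wK] := ltP (threshold K) w; first by exists k => //; exact: ltnW.
by exists K => //; rewrite /in_class -leNgt wK -thresholdS lt.
Qed.

(** [K] is the number of terms of the sequence [M], [M / 2], [M / 4], ... that are at least the
    minimum weight, with [M] the maximum weight. It counts both the classes needed and the rounds of
    the halving loop. *)
Lemma threshold_classes : (0 < ne G)%N -> let K := (Num.truncn (log2 (edge_ratio G))).+1 in
  threshold K < min_weight G /\ forall k, (k < K)%N -> min_weight G <= threshold k.
Proof.
move=> m0 K; have r1 := edge_ratio_ge1 m0; have mn0 := min_weight_gt0 m0.
have ln2 : 0 < ln 2 :> R by apply: ln_gt0; lra.
have r0 : 0 < edge_ratio G by lra.
have log0 : 0 <= log2 (edge_ratio G) by apply: divr_ge0; [exact: ln_ge0|exact: ltW].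
have /andP[lo hi] := truncn_itv log0.
have ME : max_weight G = edge_ratio G * min_weight G by rewrite divfK // gt_eqF.
have pow k : ln (2 ^+ k) = k%:R * ln 2 :> R by rewrite lnXn // mulr_natl.
rewrite /log2 ler_pdivlMr // ltr_pdivrMr // -!pow in lo hi.
rewrite ler_ln ?posrE ?exprn_gt0 // in lo; rewrite ltr_ln ?posrE ?exprn_gt0 // in hi.
split; first by rewrite /threshold ME ltr_pdivrMr ?exprn_gt0 // mulrC ltr_pM2l.
move=> k kK; rewrite /threshold ME ler_pdivlMr ?exprn_gt0 // mulrC ler_pM2r //.
apply: le_trans lo; by rewrite ler_weXn2l ?ler1n.
Qed.

Hypothesis nL : (n <= 2 ^ L)%N.

(** All neighbours of [z] in class [k] are compared with the same bound [d + threshold k]. If any of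
    their sums passes the test, so does the least one, which is [D]; one distance thus replaces a
    search over the neighbours. *)
Lemma is_min_candidateS i j k y z (a : R) :
  (i < L)%N -> (j < 2)%N -> (y < n)%N -> (z < n)%N ->
  let H := reduced G (2 ^ L) (2 ^ i) j (threshold k) in
  let D := enc (dist H y (n + z)%N) in let d := enc (dist H y z) in
  is_min (candidate i j k y z) a ->
  is_min (candidate i j k.+1 y z)
    (if (~~ (D < 0) && ~~ (d + threshold k < D)) && improves a D then D else a).
Proof.
move=> iL j2 yn zn H D d amin.
have compl u v : (u < n)%N -> (v < n)%N -> u != v ->
    codebit (2 ^ L) (2 ^ i) v u = (1 - codebit (2 ^ L) (2 ^ i) u v)%N.
  move=> un vn uv; apply: codebit_complement => //; try exact: leq_trans nL.
  by rewrite eq_sym.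
have dP := enc_dist_reducedP (2 ^ L) (2 ^ i) j (threshold k) yn zn.
have DP := enc_dist_crossP (threshold k) compl j2 yn zn.
rewrite -/H -/d in dP; rewrite -/H -/D in DP.
apply: is_min_step amin _ _ _.
- by move=> r [h [u [p [hk ? ? ? ?]]]]; exists h, u, p; split=> //; exact: ltnW.
- rewrite -!leNgt => /andP[D0 Dd]; split=> //.
  case: DP => [[u [p [yp lp [uz cu bu] DE Dmin]]]|[DE _]]; last by rewrite DE in D0; lra.
  exists k, u, p; split=> //; split=> // r yr lr; apply: le_trans Dd _; rewrite lerD2r.
  by case: dP => [[q [_ _ -> qmin]]|[_ /(_ r yr)]//]; exact: qmin.
- move=> r [h [u [p [hk yp lp [uz cu bu] [rE rle]]]]].
  have [hltk|kleh] := ltnP h k; first by left; exists h, u, p.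
  have hE : h = k by lia.
  subst h; right; case: DP => [[v [q [yq lq _ DE Dmin]]]|[_ /(_ u p yp lp uz cu bu)]//].
  have Dr : D <= r by rewrite DE rE; exact: Dmin.
  split=> //; rewrite -!leNgt; apply/andP; split.
    by rewrite DE addr_ge0 ?walk_wt_ge0 ?wt_ge0.
  (* A walk to [u] extends to [z], so here [d] is a true distance and not the code of infinity. *)
  apply: le_trans Dr _; case: dP => [[s [ys ls -> smin]]|[_ none]]; first exact: rle.
  by case: (none (rcons p z)); rewrite ?rcons_path ?yp ?lp ?last_rcons.
Qed.

(** Every candidate sum bounds the weight of some cycle from above, and the weight of a minimum
    cycle is itself a candidate sum. *)
Lemma is_min_mwc K (best : R) : threshold K < min_weight G ->
  is_min (pair_candidate K L 0) best -> best = enc (mwc G).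
Proof.
move=> thK [bP bmin].
have sound x : pair_candidate K L 0 x -> exists c, simple_cycle G c /\ cycle_wt G c <= x.
  case=> h [y [z [x0 [x1 [_ _ c0 c1 ->]]]]].
  case: c0 => k0 [u [p [_ yp lp [uz cu bu] [-> farp]]]].
  case: c1 => k1 [v [q [_ yq lq [vz cv bv] [-> farq]]]].
  apply: cycle_of_detours => //.
  (* The bits at [z] of the two neighbours are 0 and 1, so the neighbours differ. In the next two
     goals [threshold k < 2 * wt] turns the test into the strict inequality of
     [cycle_of_detours]. *)
  - by apply/eqP => uv; rewrite uv bv in bu.
  - by move=> r yr lr; have := farp r yr lr; move: cu => /andP[cu _]; lra.
  - by move=> r yr lr; have := farq r yr lr; move: cv => /andP[cv _]; lra.
have class u z : adj G u z -> exists2 k, (k < K)%N & in_class (threshold k) (wt G u z).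
  case/hasP => e eG euz; rewrite (wt_joins eG euz); apply: in_class_exists.
    exact: lt_le_trans thK (ge_min_weight eG).
  exact: le_max_weight.
case: (enc_mwcP G) => [[c [cP -> cmin]]|[-> none]]; last first.
  by case: bP => // /sound[c [cP _]]; case: (none c).
have [y [z [u [v [p [q [[yn uz vz uv] [yp lp yq lq] WE short le]]]]]]] := critical_edge cP cmin.
have [un zn uNz] := adj_bound uz; have [vn _ vNz] := adj_bound vz.
have lt x : (x < n)%N -> (x < 2 ^ L)%N by move=> xn; exact: leq_trans nL.
have [i iL sep] := codebit_separates (lt u un) (lt v vn) (lt z zn) uNz vNz uv.
have [ku kuK cu] := class u z uz; have [kv kvK cv] := class v z vz.
have cand_u : candidate i (codebit (2 ^ L) (2 ^ i) z u) K y z (walk_wt G y p + wt G u z).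
  exists ku, u, p; split=> //; split=> // r yr lr.
  have := short r yr lr; have := wt_ge0 G u z; move: cu => /andP[_]; rewrite -leNgt; lra.
(* The walk [q] weighs at most as much as the shortest walk to [z] through [u], and the edge [vz]
   weighs at most the threshold of its class. *)
have cand_v : candidate i (codebit (2 ^ L) (2 ^ i) z v) K y z (walk_wt G y q + wt G v z).
  exists kv, v, q; split=> //; split=> // r yr lr.
  have := short r yr lr; move: cv => /andP[_]; rewrite -leNgt; lra.
rewrite -WE in cmin *; set W := _ + _ in cmin *.
have cand : pair_candidate K L 0 W.
  have bit2 w : (codebit (2 ^ L) (2 ^ i) z w < 2)%N by rewrite ltn_mod.
  have [b0|b1] := eqVneq (codebit (2 ^ L) (2 ^ i) z u) 0%N.
    have b1 : codebit (2 ^ L) (2 ^ i) z v = 1%N by have := bit2 v; lia.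
    rewrite b0 in cand_u; rewrite b1 in cand_v.
    by exists i, y, z, (walk_wt G y p + wt G u z), (walk_wt G y q + wt G v z); split; first left.
  have b1' : codebit (2 ^ L) (2 ^ i) z u = 1%N by have := bit2 u; lia.
  have b0 : codebit (2 ^ L) (2 ^ i) z v = 0%N by have := bit2 v; lia.
  rewrite b1' in cand_u; rewrite b0 in cand_v.
  exists i, y, z, (walk_wt G y q + wt G v z), (walk_wt G y p + wt G u z).
  by split=> //; [left|rewrite /W addrC].
have /andP[b0 bW] := bmin _ cand; apply/eqP; rewrite eq_le bW /=.
case: bP => [E|/sound[d [dP dle]]]; first by rewrite E in b0; lra.
exact: le_trans (cmin d dP) dle.
Qed.

End Candidates.

(** * Program logic *)

Fixpoint imods (c : cmd) : seq nat :=
  match c with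
  | IPut a _ _ => [:: a]
  | Seq c1 c2 | If _ c1 c2 => imods c1 ++ imods c2
  | While _ c1 => imods c1
  | Query c1 => [:: 3; 4; 5]%N ++ imods c1
  | _ => [::]
  end.

Fixpoint rmods (c : cmd) : seq nat :=
  match c with
  | RPut a _ _ => [:: a]
  | Seq c1 c2 | If _ c1 c2 => rmods c1 ++ rmods c2
  | While _ c1 => rmods c1
  | Query c1 => [:: 1; 2]%N ++ rmods c1
  | _ => [::]
  end.

(** Every execution satisfies this, so that invariants need to speak only of the arrays that
    change. *)
Definition framed (R : realType) (c : cmd) (s s' : state R) : Prop :=
  (forall a k, a \notin imods c -> ints s' a k = ints s a k) /\
  (forall a k, a \notin rmods c -> reals s' a k = reals s a k).

Lemma exec_framed (R : realType) W (Q : problem R) c s s' t tr :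
  exec W Q c s s' t tr -> framed c s s'.
Proof.
elim=> {c s s' t tr}.
- by [].
- by move=> a i e s k x _ _; split=> //= b l; rewrite inE /upd => /negPf ->.
- by move=> a i e s k x _ _; split=> //= b l; rewrite inE /upd => /negPf ->.
- move=> c1 c2 s s1 s2 t1 t2 tr1 tr2 _ [I1 R1] _ [I2 R2].
  by split=> a k /=; rewrite mem_cat negb_or => /andP[? ?]; rewrite ?I2 ?I1 ?R2 ?R1.
- move=> b c1 c2 s s' v t tr _ _ [I1 R1].
  by split=> a k /=; rewrite mem_cat negb_or => /andP[? ?]; rewrite ?I1 ?R1 //; case: (v).
- move=> b c s s' t tr _ [I1 R1].
  split=> a k /= am; [rewrite I1 //|rewrite R1 //];
    by rewrite /= cats0 mem_cat negb_or am.
- move=> c s s1 t H _ [I1 R1] _; split=> a k; rewrite [_ c]/= mem_cat negb_or => /andP[a1 a2] /=.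
    by rewrite I1 //= (negPf a1).
  by move: a1; rewrite !inE negb_or => /andP[/negPf a1 /negPf ->]; rewrite R1 //= a1.
Qed.

Section Logic.
Variables (R : realType) (W : nat) (Q : problem R) (P : nat * wgraph R -> Prop).

(** Total correctness with resources: [T] bounds the time outside the query constructions, [q] the
    number of oracle calls, and every recorded call satisfies [P]. The frame is carried along for
    use in [runs_weaken]. *)
Definition runs (c : cmd) (s : state R) (T q : nat) (Post : state R -> Prop) : Prop :=
  exists s' t tr, [/\ exec W Q c s s' t tr, (t <= T)%N, (size tr <= q)%N,
    (forall x, x \in tr -> P x) & framed c s s' /\ Post s'].

Lemma runs_weaken c s T T' q q' (Post Post' : state R -> Prop) :
  runs c s T q Post -> (T <= T')%N -> (q <= q')%N ->
  (forall s', framed c s s' -> Post s' -> Post' s') ->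
  runs c s T' q' Post'.
Proof.
move=> [s' [t [tr [ex tT trq trP [fr po]]]]] TT qq imp; exists s', t, tr; split=> //.
- exact: leq_trans TT.
- exact: leq_trans qq.
- by split=> //; exact: imp.
Qed.

Lemma runs_seq c1 c2 s T1 T2 q1 q2 (Post : state R -> Prop) :
  runs c1 s T1 q1 (fun s1 => runs c2 s1 T2 q2 Post) ->
  runs (Seq c1 c2) s (T1 + T2) (q1 + q2) Post.
Proof.
move=> [s1 [t1 [tr1 [e1 tT1 q1le P1 [_ [s2 [t2 [tr2 [e2 tT2 q2le P2 [_ po]]]]]]]]]].
have e : exec W Q (Seq c1 c2) s s2 (t1 + t2)%N (tr1 ++ tr2) by exact: ESeq e1 e2.
exists s2, (t1 + t2)%N, (tr1 ++ tr2); split=> //.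
- exact: leq_add.
- by rewrite size_cat leq_add.
- by move=> x; rewrite mem_cat => /orP[/P1|/P2].
- by split=> //; exact: exec_framed e.
Qed.

Lemma framed_refl c (s : state R) : framed c s s.
Proof. by []. Qed.

Lemma framed_trans c c1 c2 (s1 s2 s3 : state R) : framed c1 s1 s2 -> framed c2 s2 s3 ->
  {subset imods c1 <= imods c} -> {subset imods c2 <= imods c} ->
  {subset rmods c1 <= rmods c} -> {subset rmods c2 <= rmods c} -> framed c s1 s3.
Proof.
move=> [i1 r1] [i2 r2] si1 si2 sr1 sr2; split=> a k am.
  by rewrite i2 ?i1 //; apply: contra am; [exact: si1|exact: si2].
by rewrite r2 ?r1 //; apply: contra am; [exact: sr1|exact: sr2].
Qed.

(** [I i] is the invariant after [i] rounds. A round costs one test besides its body; leaving the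
    loop costs a test and a [Skip], whence the summand 2. *)
Lemma runs_while (I : nat -> state R -> Prop) b c N T q s0 :
  (forall i s, (i < N)%N -> framed c s0 s -> I i s ->
     beval W s b = Some true /\ runs c s T q (I i.+1)) ->
  (forall s, framed c s0 s -> I N s -> beval W s b = Some false) ->
  I 0%N s0 -> runs (While b c) s0 (N * T.+1 + 2) (N * q) (I N).
Proof.
move=> step stop I0.
suff H d i s : (i + d)%N = N -> framed c s0 s -> I i s ->
    exists s' t tr, [/\ exec W Q (While b c) s s' t tr, (t <= d * T.+1 + 2)%N,
      (size tr <= d * q)%N, (forall x, x \in tr -> P x) & I N s'].
  have [s' [t [tr [ex tT trq trP po]]]] := H N 0%N s0 (add0n N) (framed_refl c s0) I0.
  by exists s', t, tr; split=> //; split=> //; exact: exec_framed ex.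
elim: d i s => [|d IH] i s.
  rewrite addn0 => -> fr Is; exists s, 2%N, [::]; split=> //.
  by apply: EWhile; apply: EIf (stop s fr Is) _; exact: ESkip.
move=> idN fr Is; have [|bt [s1 [t1 [tr1 [e1 tT1 q1 P1 [fr1 I1]]]]]] := step i s _ fr Is; first lia.
have fr' : framed c s0 s1 by exact: framed_trans fr fr1 _ _ _ _.
have [|s2 [t2 [tr2 [e2 tT2 q2 P2 I2]]]] := IH i.+1 s1 _ fr' I1; first lia.
exists s2, (t1 + t2).+1, (tr1 ++ tr2); split=> //.
- by apply: EWhile; apply: EIf bt _; apply: ESeq e1 e2.
- by rewrite mulSn; lia.
- by rewrite size_cat mulSn leq_add.
- by move=> x; rewrite mem_cat => /orP[/P1|/P2].
Qed.

Lemma runs_query c s T (H : wgraph R) :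
  (exists s' t, [/\ exec W Q c (clear_query s) s' t [::], (t <= T)%N & query_graph s' H]) ->
  (forall t, (t <= T)%N -> P (t, H)) ->
  runs (Query c) s 1 1 (fun s' => forall k, (k < size (Q H))%N -> reals s' 2 k = nth 0 (Q H) k).
Proof.
move=> [s1 [t [e tT qg]]] PH; exists (write_answer s1 (Q H)), 1%N, [:: (t, H)].
have ex := EQuery e qg; split=> //; first by move=> x; rewrite inE => /eqP ->; exact: PH.
by split=> [|k kH]; [exact: exec_framed ex|exact: set_nth_default].
Qed.

(** Meant for code without loops and oracle calls; those are left to [runs_while] and [runs_query],
    hence the value [False]. *)
Fixpoint wp (c : cmd) (s : state R) (Post : state R -> Prop) : Prop :=
  match c with
  | Skip => Post s
  | IPut a i e =>
      if ieval W s i is Some k then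
        if ieval W s e is Some x then Post (State (upd (ints s) a k x) (reals s)) else False
      else False
  | RPut a i e =>
      if ieval W s i is Some k then
        if reval W s e is Some x then Post (State (ints s) (upd (reals s) a k x)) else False
      else False
  | Seq c1 c2 => wp c1 s (fun s1 => wp c2 s1 Post)
  | If b c1 c2 => if beval W s b is Some v then if v then wp c1 s Post else wp c2 s Post else False
  | _ => False
  end.

Lemma wp_iput a i e s k x (Post : state R -> Prop) :
  ieval W s i = Some k -> ieval W s e = Some x ->
  Post (State (upd (ints s) a k x) (reals s)) -> wp (IPut a i e) s Post.
Proof. by move=> /= -> ->. Qed.

Lemma wp_rput a i e s k x (Post : state R -> Prop) :
  ieval W s i = Some k -> reval W s e = Some x ->
  Post (State (ints s) (upd (reals s) a k x)) -> wp (RPut a i e) s Post.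
Proof. by move=> /= -> ->. Qed.

Lemma wp_if b c1 c2 s v (Post : state R -> Prop) :
  beval W s b = Some v -> wp (if v then c1 else c2) s Post -> wp (If b c1 c2) s Post.
Proof. by move=> /= ->; case: v. Qed.

Lemma wp_seq c1 c2 s (Post : state R -> Prop) :
  wp c1 s (fun s1 => wp c2 s1 Post) -> wp (Seq c1 c2) s Post.
Proof. by []. Qed.

Fixpoint cost (c : cmd) : nat :=
  match c with
  | Seq c1 c2 => cost c1 + cost c2
  | If _ c1 c2 => (maxn (cost c1) (cost c2)).+1
  | _ => 1
  end.

Lemma runs_wp c s (Post : state R -> Prop) : wp c s Post -> runs c s (cost c) 0 Post.
Proof.
suff H : wp c s Post -> exists s' t, [/\ exec W Q c s s' t [::], (t <= cost c)%N & Post s'].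
  case/H => s' [t [ex tT po]]; exists s', t, [::].
  by split=> //; split=> //; exact: exec_framed ex.
elim: c s Post => //=.
- by move=> s Post po; exists s, 1%N; split=> //; exact: ESkip.
- move=> a i e s Post; case Ei: ieval => [k|] //; case Ee: ieval => [x|] // po.
  by exists (State (upd (ints s) a k x) (reals s)), 1%N; split=> //; exact: EIPut.
- move=> a i e s Post; case Ei: ieval => [k|] //; case Ee: reval => [x|] // po.
  by exists (State (ints s) (upd (reals s) a k x)), 1%N; split=> //; exact: ERPut.
- move=> c1 IH1 c2 IH2 s Post /IH1[s1 [t1 [e1 tT1 /IH2[s2 [t2 [e2 tT2 po]]]]]].
  exists s2, (t1 + t2)%N; split=> //; last exact: leq_add.
  by rewrite -[[::]]/([::] ++ [::]); exact: ESeq e1 e2.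
- move=> b c1 IH1 c2 IH2 s Post; case Eb: beval => [v|] // po.
  have [s' [t [ex tT po']]] : exists s' t, [/\ exec W Q (if v then c1 else c2) s s' t [::],
      (t <= maxn (cost c1) (cost c2))%N & Post s'].
    case: v po {Eb} => [/IH1|/IH2] [s' [t [ex tT po']]]; exists s', t; split=> //.
      by rewrite (leq_trans tT) ?leq_maxl.
    by rewrite (leq_trans tT) ?leq_maxr.
  by exists s', t.+1; split=> //; exact: EIf Eb ex.
Qed.

Lemma runs_wp_seq c1 c2 s T q (Post : state R -> Prop) :
  wp c1 s (fun s1 => runs c2 s1 T q Post) -> runs (Seq c1 c2) s (cost c1 + T) q Post.
Proof. by move=> H; apply: (runs_seq (q1 := 0)); exact: runs_wp. Qed.
End Logic.

Lemma wordE W k : (k <= W)%N -> word W k = Some k.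
Proof. by rewrite /word => ->. Qed.

(** * The program *)

(* Scalar variables are arrays used at index 0.  Integers: 6 is the index of the
   innermost loop, 7 the number of edges of the query graph, 8 the power of two
   [N], 9 the current power of two [2 ^ i].  Reals: 4 is the threshold, 5 and 6
   the least and largest weights, 9 the best sum so far; arrays 7 and 8 hold, for
   each pair of vertices, the least candidates for the two values of the bit. *)
Definition ivar (a : nat) : iexp := IGet a (IConst 0).
Definition rvar (a : nat) : rexp := RGet a (IConst 0).
Definition iset (a : nat) (e : iexp) : cmd := IPut a (IConst 0) e.
Definition rset (a : nat) (e : rexp) : cmd := RPut a (IConst 0) e.
Definition nexp : iexp := IGet 0 (IConst 0).
Definition mexp : iexp := IGet 0 (IConst 1).
Definition incr (a : nat) : cmd := iset a (IOp IAdd (ivar a) (IConst 1)).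
Definition minus1 : rexp := ROp RSub (RConst 0) (RConst 1).

Definition for_loop (bound : iexp) (body : cmd) : cmd :=
  Seq (iset 6 (IConst 0)) (While (BILt (ivar 6) bound) (Seq body (incr 6))).

Definition weight : rexp := RGet 0 (ivar 6).

Definition scan_body : cmd :=
  Seq (If (BRLt (rvar 6) weight) (rset 6 weight) Skip)
      (If (BRLt weight (rvar 5)) (rset 5 weight) Skip).

Definition scan : cmd :=
  Seq (Seq (rset 6 (RGet 0 (IConst 0))) (rset 5 (RGet 0 (IConst 0))))
      (for_loop mexp scan_body).

Definition power : cmd :=
  Seq (iset 8 (IConst 1))
      (While (BILt (ivar 8) nexp) (iset 8 (IOp IMul (ivar 8) (IConst 2)))).

(** Machine form of [codebit], with [N] in variable 8 and [2 ^ i] in variable 9. *)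
Definition bit_exp (z u : iexp) : iexp :=
  let N1 := IOp IAdd (ivar 8) (IConst 1) in
  IOp IMod (IOp IDiv
    (IOp ISub (IOp IMod (IOp ISub (IOp IAdd u N1) z) N1) (IConst 1)) (ivar 9)) (IConst 2).

Definition eq_const (e : iexp) (j : nat) : bexp :=
  BAnd (BNot (BILt e (IConst j))) (BNot (BILt (IConst j) e)).

Definition tail_exp : iexp := IGet 1 (ivar 6).
Definition head_exp : iexp := IGet 2 (ivar 6).

Definition copy_edge : cmd :=
  Seq (IPut 4 (ivar 6) tail_exp) (Seq (IPut 5 (ivar 6) head_exp) (RPut 1 (ivar 6) weight)).

Definition put_arc (u v : iexp) : cmd :=
  Seq (IPut 4 (ivar 7) u) (IPut 5 (ivar 7) (IOp IAdd nexp v)).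

Definition cross_edge (j : nat) : cmd :=
  If (BAnd (BRLt (ROp RDiv (rvar 4) (RConst 2)) weight) (BNot (BRLt (rvar 4) weight)))
     (Seq (If (eq_const (bit_exp head_exp tail_exp) j)
              (put_arc tail_exp head_exp) (put_arc head_exp tail_exp))
          (Seq (RPut 1 (ivar 7) weight) (incr 7)))
     Skip.

Definition build (j : nat) : cmd :=
  Seq (Seq (IPut 3 (IConst 0) (IOp IMul (IConst 2) nexp)) (iset 7 mexp))
  (Seq (for_loop mexp (Seq copy_edge (cross_edge j)))
       (IPut 3 (IConst 1) (ivar 7))).

Definition nn : iexp := IOp IMul nexp nexp.

Definition improves_exp (a x : rexp) : bexp :=
  BNot (BAnd (BNot (BRLt a (RConst 0))) (BNot (BRLt x a))).

(** The loop index is [y * n + z], whereas rows of the oracle's matrix have length [2 * n]. This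
    entry is the distance from [y] to [z], and [far_exp] the one to the second copy of [z]. *)
Definition near_exp : rexp :=
  RGet 2 (IOp IAdd (IOp IMul (IOp IDiv (ivar 6) nexp) (IOp IMul (IConst 2) nexp))
                   (IOp IMod (ivar 6) nexp)).
Definition far_exp : rexp :=
  RGet 2 (IOp IAdd (IOp IMul (IOp IDiv (ivar 6) nexp) (IOp IMul (IConst 2) nexp))
                   (IOp IAdd nexp (IOp IMod (ivar 6) nexp))).

Definition update_body (j : nat) : cmd :=
  If (BAnd (BAnd (BNot (BRLt far_exp (RConst 0)))
                 (BNot (BRLt (ROp RAdd near_exp (rvar 4)) far_exp)))
           (improves_exp (RGet (7 + j)%N (ivar 6)) far_exp))
     (RPut (7 + j)%N (ivar 6) far_exp) Skip.

Definition round (j : nat) : cmd := Seq (Query (build j)) (for_loop nn (update_body j)).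

Definition clear_body : cmd := Seq (RPut 7 (ivar 6) minus1) (RPut 8 (ivar 6) minus1).

(** Halving the threshold until it falls below the least weight gives the right number of rounds
    without rounding a logarithm, which the machine could not do. *)
Definition class_loop : cmd :=
  Seq (rset 4 (rvar 6))
      (While (BNot (BRLt (rvar 4) (rvar 5)))
             (Seq (round 0) (Seq (round 1) (rset 4 (ROp RDiv (rvar 4) (RConst 2)))))).

Definition combine_body : cmd :=
  let x0 := RGet 7 (ivar 6) in let x1 := RGet 8 (ivar 6) in
  If (BAnd (BAnd (BNot (BRLt x0 (RConst 0))) (BNot (BRLt x1 (RConst 0))))
           (improves_exp (rvar 9) (ROp RAdd x0 x1)))
     (rset 9 (ROp RAdd x0 x1)) Skip.

Definition bit_body : cmd :=
  Seq (for_loop nn clear_body)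
  (Seq class_loop
  (Seq (for_loop nn combine_body) (iset 9 (IOp IMul (ivar 9) (IConst 2))))).

Definition main_cmd : cmd :=
  Seq scan (Seq power (Seq (Seq (rset 9 minus1) (iset 9 (IConst 1)))
  (Seq (While (BILt (ivar 9) (ivar 8)) bit_body) (RPut 3 (IConst 0) (rvar 9))))).

Definition mwc_program : cmd :=
  If (BILt (IConst 0) mexp) main_cmd (RPut 3 (IConst 0) minus1).

Lemma ne_le_square (R : realType) (G : wgraph R) : (ne G <= nv G * nv G)%N.
Proof.
have /andP[_ pw] := wgraph_simple G.
have : uniq [seq e.1 | e <- edges G].
  rewrite uniq_pairwise pairwise_map; move: pw; apply: sub_pairwise => e f.
  by apply: contra => /= /eqP E; rewrite /joins E -surjective_pairing eqxx.
rewrite /ne -(size_map fst) => /uniq_leq_size H.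
have := size_allpairs pair (iota 0 (nv G)) (iota 0 (nv G)); rewrite !size_iota => <-.
apply: H => x /mapP[e eG ->]; have [en en' _ _] := edges_ok eG.
by apply/allpairsP; exists e.1; rewrite !mem_iota -surjective_pairing.
Qed.

Lemma nv_ge2 (R : realType) (G : wgraph R) : (0 < ne G)%N -> (1 < nv G)%N.
Proof.
rewrite /ne; case E: (edges G) => [//|e s] _.
have /edges_ok[] : e \in edges G by rewrite E inE eqxx.
by case: e {E} => -[u v] w /=; lia.
Qed.

(** Differences, quotients and remainders do not exceed their first operand, so it suffices to bound
    that operand. *)
Ltac small_word := solve
  [ apply: leq_trans (leq_subr _ _) _; small_word
  | apply: leq_trans (leq_div _ _) _; small_word
  | apply: leq_trans (leq_mod _ _) _; small_word
  | lia ].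

Ltac evalw H :=
  repeat (rewrite /upd /= ?H; match goal with |- context [word ?W ?k] =>
            rewrite (@wordE W k); [|small_word] end);
  rewrite /upd /= ?H.

(* With [apply:] instead of [refine] the unifier would start evaluating [wp]. *)
Ltac wp_split := refine (wp_seq _).

Ltac wp_put H :=
  first [refine (wp_iput _ _ _)|refine (wp_rput _ _ _)]; [by evalw H|by evalw H|].

Lemma beval_eq_const (R : realType) W (s : state R) e j x :
  ieval W s e = Some x -> (j <= W)%N -> beval W s (eq_const e j) = Some (x == j).
Proof.
move=> /= -> jW; rewrite /= wordE //=; congr Some; lia.
Qed.

(** To the body a round adds a test and an increment; initialisation and exit cost 3. The bound
    [N < W] keeps the counter a machine word, and the invariant must be insensitive to writes to
    it. *)
Lemma runs_for (R : realType) W (Q : problem R) P bound N body T q (I : nat -> state R -> Prop) s0 :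
  (N < W)%N -> 6%N \notin imods body ->
  (forall s, framed (for_loop bound body) s0 s -> ieval W s bound = Some N) ->
  (forall i s x, I i s -> I i (State (upd (ints s) 6 0 x) (reals s))) ->
  (forall i s, (i < N)%N -> framed (for_loop bound body) s0 s -> ints s 6 0 = i -> I i s ->
     runs W Q P body s T q (I i.+1)) ->
  I 0%N s0 ->
  runs W Q P (for_loop bound body) s0 (N * T.+2 + 3) (N * q) (I N).
Proof.
move=> NW b6 bE I6 step I0.
pose J i s := ints s 6 0 = i /\ I i s.
apply: (@runs_weaken _ _ _ _ _ _ (1 + (N * T.+2 + 2)) _ (N * q) _ (J N)) => [|||s _ []]; [|lia|by []|by []].
have W1 : (1 <= W)%N by lia.
apply: runs_wp_seq; rewrite /= ?wordE //=; set s1 := State _ _.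
have fr1 : framed (for_loop bound body) s0 s1.
  by split=> a k //=; rewrite inE negb_or /upd => /andP[/negPf ->].
have sub s : framed (Seq body (incr 6)) s1 s -> framed (for_loop bound body) s0 s.
  by move=> fr; apply: framed_trans fr1 fr _ _ _ _ => a //=; rewrite inE => ->; rewrite orbT.
apply: runs_while => [i s iN fr [si Is]|s fr [si Is]|]; last by split=> //; exact: I6.
  split; first by evalw si; rewrite (bE s (sub s fr)) /= iN.
  rewrite -[T.+1]addn1 -[q]addn0; apply: runs_seq.
  apply: runs_weaken (step i s iN (sub s fr) si Is) (leqnn _) (leqnn _) _.
  move=> s2 [fi2 _] Is2; apply: runs_wp; have s2i : ints s2 6 0 = i by rewrite fi2.
  by evalw s2i; split=> /=; [rewrite addn1|exact: I6].
by evalw si; rewrite (bE s (sub s fr)) /= ltnn.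
Qed.

(** * Correctness of the weight scan, the power of two and the construction of reduced graphs *)

Section Correctness.
Variables (R : realType) (G : wgraph R) (W : nat) (P : nat * wgraph R -> Prop).
Notation n := (nv G).
Notation m := (ne G).
Hypothesis m_gt0 : (0 < m)%N.
Hypothesis W_large : (4 * (n * n) + 8 * n + 16 <= W)%N.

Notation runs := (runs W (@APSD R) P).

Definition has_input (s : state R) : Prop :=
  (forall a k, (a < 3)%N -> ints s a k = ints (input_state G) a k) /\
  (forall k, reals s 0 k = reals (input_state G) 0 k).

Lemma has_input_framed c s s' : framed c s s' -> has_input s ->
  all (leq 3) (imods c) -> 0%N \notin rmods c -> has_input s'.
Proof.
move=> [fi fr] [hi hr] /allP ci cr; split=> [a k a3|k]; last by rewrite fr ?hr.
by rewrite fi ?hi //; apply/negP => /ci; rewrite leqNgt a3.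
Qed.

Lemma input_nv s : has_input s -> ints s 0 0 = n. Proof. by case=> -> . Qed.
Lemma input_ne s : has_input s -> ints s 0 1 = m. Proof. by case=> -> . Qed.

Let edge (k : nat) : wedge R := nth (0%N, 0%N, 0) (edges G) k.

Lemma edge_in k : (k < m)%N -> edge k \in edges G. Proof. exact: mem_nth. Qed.

Lemma input_edge s k : has_input s -> (k < m)%N ->
  [/\ ints s 1 k = (edge k).1.1, ints s 2 k = (edge k).1.2 & reals s 0 k = (edge k).2].
Proof.
by case=> hi hr km; rewrite !hi // hr /= !(nth_map (0%N, 0%N, 0)).
Qed.

Lemma runs_scan s0 : has_input s0 ->
  runs scan s0 (m * 6 + 5) 0
    (fun s => reals s 6 0 = max_weight G /\ reals s 5 0 = min_weight G).
Proof.
move=> inp; apply: (@runs_weaken _ _ _ _ _ _ (2 + (m * 6 + 3)) _ (m * 0) _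
  (* The two registers bound all weights and are themselves weights of edges; these facts
     characterise the maximum and the minimum. *)
  (fun s => (forall k, (k < m)%N -> reals s 5 0 <= (edge k).2 <= reals s 6 0) /\
    exists k l, [/\ (k < m)%N, (l < m)%N, reals s 5 0 = (edge k).2 & reals s 6 0 = (edge l).2])).
- have [_ _ w0] := input_edge inp m_gt0.
  have mW : (m < W)%N by have := ne_le_square G; lia.
  apply: runs_wp_seq; evalw w0.
  set s1 := State _ _.
  apply: (runs_for (I := fun i s =>
    (forall k, (k < i)%N -> reals s 5 0 <= (edge k).2 <= reals s 6 0) /\
    exists k l, [/\ (k < m)%N, (l < m)%N, reals s 5 0 = (edge k).2 & reals s 6 0 = (edge l).2])) => //.
  + move=> s [fi _]; have inp' : ints s 0 1 = m by rewrite fi //= input_ne.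
    by evalw inp'.
  + move=> i s im [fi fr] si [lo [k [l [km lm E5 E6]]]].
    have [_ _ wi] := input_edge inp im.
    have wi' : reals s 0 i = (edge i).2 by rewrite fr.
    apply: runs_wp; evalw (si, wi').
    have bound k0 : (k0 < i.+1)%N -> k0 = i \/ reals s 5 0 <= (edge k0).2 <= reals s 6 0.
      by rewrite ltnS leq_eqVlt => /orP[/eqP|/lo]; [left|right].
    case: ltP => Hmx; case: ltP => Hmn; split; do ?[by exists k, l|by exists i, l|by exists k, i|by exists i, i];
      move=> k0 /bound[->|]; lra.
  + by split=> //; exists 0%N, 0%N; split=> //; rewrite /s1 /= /upd /= ?w0.
- by lia.
- by rewrite muln0.
move=> s _ [all_ [k [l [km lm E5 E6]]]].
have all_e e : e \in edges G -> reals s 5 0 <= e.2 <= reals s 6 0.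
  by move=> eG; rewrite -[e](nth_index (0%N, 0%N, 0) eG); apply: all_; rewrite index_mem.
split; apply/eqP; rewrite eq_le; apply/andP; split.
- by rewrite E6 le_max_weight ?edge_in.
- apply: max_weight_lub => [|e /all_e/andP[]//].
  by rewrite E6; have [_ _ _ /ltW] := edges_ok (edge_in lm).
- apply: min_weight_glb => [|e /all_e/andP[]//].
  by rewrite E5 le_max_weight ?edge_in.
- by rewrite E5 ge_min_weight ?edge_in.
Qed.

Lemma runs_power s0 : has_input s0 ->
  runs power s0 (2 * up_log 2 n + 3) 0 (fun s => ints s 8 0 = 2 ^ up_log 2 n)%N.
Proof.
move=> inp; have n2 := nv_ge2 m_gt0; set L := up_log 2 n.
have Lgt i : (i < L)%N -> (2 ^ i < n)%N.
  by move=> iL; rewrite ltnNge; apply/negP => /(up_log_min (leqnn 2)); rewrite leqNgt iL.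
apply: (@runs_weaken _ _ _ _ _ _ (1 + (L * 2 + 2)) _ (L * 0) _ (fun s => ints s 8 0 = 2 ^ L)%N) => //.
- apply: runs_wp_seq; evalw inp.
  apply: (runs_while (I := fun i s => ints s 8 0 = 2 ^ i)%N) => [i s iL [fi _] si|s [fi _] si|//].
    have sn : ints s 0 0 = n by rewrite fi // /= /upd /= input_nv.
    have lt := Lgt i iL; split; first by evalw (si, sn); rewrite lt.
    by apply: runs_wp; evalw (si, sn); rewrite expnS mulnC.
  have sn : ints s 0 0 = n by rewrite fi // /= /upd /= input_nv.
  have := up_logP n (leqnn 2); rewrite -/L => nL.
  (* Keeps the final power of two within the word bound. *)
  have L2 : (2 ^ L <= 2 * n)%N.
    have := Lgt L.-1; case: (L) nL => [|L'] /= nL; first by rewrite expn0; lia.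
    by move=> /(_ (leqnn _)); rewrite expnS; lia.
  by evalw (si, sn); rewrite ltnNge nL.
- by lia.
- by rewrite muln0.
Qed.

Lemma runs_build j N b th s0 : has_input s0 -> (j < 2)%N -> (n <= N <= 2 * n)%N -> (b <= N)%N ->
  ints s0 8 0 = N -> ints s0 9 0 = b -> reals s0 4 0 = th ->
  runs (build j) s0 (m * 11 + 6) 0 (fun s => query_graph s (reduced G N b j th)).
Proof.
move=> inp j2 /andP[nN N2n] bN s08 s09 s04.
have n2 := nv_ge2 m_gt0; have mnn := ne_le_square G.
have two0 : (2%:R == 0 :> R) = false by rewrite pnatr_eq0.
pose X i := crossings G N b j th (take i (edges G)).
have XS i : (i < m)%N -> X i.+1 =
    if in_class th (edge i).2 then rcons (X i) (cross G N b j (edge i)) else X i.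
  move=> im; rewrite /X (take_nth (0%N, 0%N, 0)) // /crossings filter_rcons.
  by case: ifP => // _; rewrite map_rcons.
have Xsize i : (i < m)%N -> (size (X i) <= i)%N.
  move=> im; rewrite size_map size_filter; apply: leq_trans (count_size _ _) _.
  by rewrite size_take; case: ltnP => // ?; lia.
(* Copied edges fill the positions below [m] and arcs the positions from [m] on, so a single pass
   writes both lists without collision. [X i] lists the arcs of the first [i] edges. *)
pose Inv i (s : state R) := [/\ ints s 7 0 = (m + size (X i))%N,
  forall k, (k < i)%N -> edge k = (ints s 4 k, ints s 5 k, reals s 1 k) &
  forall k, (k < size (X i))%N ->
    nth (0%N, 0%N, 0) (X i) k = (ints s 4 (m + k), ints s 5 (m + k), reals s 1 (m + k))%N].
have sn := input_nv inp; have sm := input_ne inp.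
apply: (@runs_weaken _ _ _ _ _ _ (2 + (m * 11 + 3 + 1)) _ (m * 0 + 0) _
  (fun s => ints s 3 0 = (2 * n)%N /\ ints s 3 1 = (m + size (X m))%N /\ Inv m s)) => //.
- apply: runs_wp_seq; evalw (sn, sm); set s1 := State _ _.
  apply: runs_seq; apply: (@runs_weaken _ _ _ _ _ _ (m * 11 + 3) _ (m * 0) _ (Inv m)) => //.
    apply: runs_for => //; first lia.
    + move=> s [fi _]; have sm' : ints s 0 1 = m by rewrite fi.
      by evalw sm'.
    + move=> i s im [fi fr] si [s7 Icopy Icross].
      have [e1 e2 e3] := input_edge inp im; have [un vn uv w0] := edges_ok (edge_in im).
      have Xi := Xsize i im; have XSi := XS i im.
      have Ec : edge i = ((edge i).1.1, (edge i).1.2, (edge i).2).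
        by case: (edge i) => -[].
      move: Ec e1 e2 e3 un vn uv XSi; set u := (edge i).1.1; set v := (edge i).1.2; set w := (edge i).2.
      move: u v w => u v w Ec e1 e2 e3 un vn uv XSi.
      have s_n : ints s 0 0 = n by rewrite fi.
      have s_1 : ints s 1 i = u by rewrite fi.
      have s_2 : ints s 2 i = v by rewrite fi.
      have s_w : reals s 0 i = w by rewrite fr.
      have s_8 : ints s 8 0 = N by rewrite fi.
      have s_9 : ints s 9 0 = b by rewrite fi.
      have s_4 : reals s 4 0 = th by rewrite fr.
      apply: runs_wp; set Post := Inv i.+1; pose E := (si, s7, s_n, s_1, s_2, s_w, s_8, s_9, s_4, two0).
      do 2 wp_split.
      wp_put E; wp_split; wp_put E; wp_put E.
      have old k : (k < i.+1)%N -> k = i \/ k != i /\ (k < i)%N.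
        by rewrite ltnS leq_eqVlt => /orP[/eqP|lt]; [left|right; split; first apply/eqP; lia].
      refine (wp_if (v := in_class th w) _ _); first by evalw E.
      case: (in_class th w) XSi => XSi; last first.
        rewrite /= /Post /Inv XSi /= /upd /=; split=> // k.
          by move=> /old[->|[/negPf -> /Icopy //]]; rewrite !eqxx.
        move=> kX; have neq : (m + k == i)%N = false by apply/eqP; lia.
        by rewrite neq Icross.
      set x := (m + size (X i))%N in s7 E *.
      (* Covers both orientations of the new arc, written at position [x]. *)
      have fin a c : cross G N b j (edge i) = (a, n + c, w)%N ->
          Post (State (upd (upd (upd (upd (upd (ints s) 4 i u) 5 i v) 4 x a) 5 x (n + c)%N) 7 0 x.+1)
                      (upd (upd (reals s) 1 i w) 1 x w)).
        move=> Ea; rewrite /Post /Inv XSi Ea size_rcons addnS -/x /upd /=; split=> // k.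
          move=> kS; have neq : (k == x) = false by apply/eqP; rewrite /x; lia.
          rewrite neq.
          by case/old: kS => [->|[/negPf -> /Icopy //]]; rewrite !eqxx.
        rewrite ltnS leq_eqVlt nth_rcons => /orP[/eqP ->|kX]; first by rewrite ltnn -/x !eqxx.
        have neqx : (m + k == x)%N = false by apply/eqP; rewrite /x; lia.
        have neqi : (m + k == i)%N = false by apply/eqP; lia.
        by rewrite kX neqx neqi Icross.
      wp_split.
      match goal with |- wp _ _ ?st _ => set s2 := st end.
      have bitE : ieval W s2 (bit_exp head_exp tail_exp) = Some (codebit N b v u).
        by rewrite /s2 /codebit /code -[N.+1]addn1; evalw E.
      have crossEi : cross G N b j (edge i) =
          if codebit N b v u == j then (u, n + v, w)%N else (v, n + u, w)%N by rewrite Ec.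
      refine (wp_if _ _); first by apply: beval_eq_const bitE _; lia.
      by case: (codebit N b v u == j) crossEi => crossEi; rewrite /s2; wp_split; wp_put E; wp_put E;
        wp_split; wp_put E; wp_put E; rewrite addn1; exact: fin crossEi.
    + by split=> //=; rewrite /X take0 // addn0.
  move=> s [fi _] [s7 Icopy Icross].
  have XW : (m + size (X m) <= W)%N.
    have : (size (X m) <= m)%N by rewrite /X /ne take_size size_map size_filter count_size.
    by lia.
  apply: runs_wp; wp_put s7; rewrite /= /upd /=; split; first by rewrite fi.
  by split=> //; split.
- by lia.
- by rewrite muln0.
move=> s _ [s30 [s31 [_ Icopy Icross]]].
have XE : X m = crossings G N b j th (edges G) by rewrite /X take_oversize.
have neE : ne (reduced G N b j th) = (m + size (X m))%N by rewrite /ne /edges /= size_cat -XE.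
split; [by rewrite s30|by rewrite neE|rewrite neE => k kH].
rewrite /edges /= nth_cat -XE; case: ltnP => km; first exact: Icopy.
rewrite Icross; last by rewrite ltn_subLR.
by rewrite subnKC.
Qed.
End Correctness.

Lemma nth_allpairs_iota (S T : Type) (x0 : T) (z0 : S) (f : nat -> S -> T) (s : seq S) k a y x :
  (y < k)%N -> (x < size s)%N ->
  nth x0 [seq f u v | u <- iota a k, v <- s] (y * size s + x) = f (a + y)%N (nth z0 s x).
Proof.
elim: k a y => // k IH a [|y] yk xs /=; rewrite nth_cat size_map.
  by rewrite mul0n add0n xs (nth_map z0) // addn0.
by rewrite mulSn -addnA ltnNge leq_addr /= addKn IH // addSnnS.
Qed.

Lemma nth_APSD (R : realType) (H : wgraph R) y x : (y < nv H)%N -> (x < nv H)%N ->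
  nth 0 (APSD H) (y * nv H + x) = enc (dist H y x).
Proof.
move=> yn xn; have := @nth_allpairs_iota nat R 0 0%N (fun u v => enc (dist H u v)) (iota 0 (nv H)) (nv H) 0 y x yn.
rewrite size_iota => /(_ xn) ->.
by rewrite add0n nth_iota.
Qed.

(** * Correctness of the loops over bits, classes and pairs *)

Section MainLoop.
Variables (R : realType) (G : wgraph R) (W : nat) (P : nat * wgraph R -> Prop).
Notation n := (nv G).
Notation m := (ne G).
Hypothesis m_gt0 : (0 < m)%N.
Hypothesis W_large : (4 * (n * n) + 8 * n + 16 <= W)%N.
Hypothesis P_reduced : forall t H, (t <= m * 11 + 6)%N -> reduced_graph G H -> P (t, H).

Notation runs := (runs W (@APSD R) P).
Variable L : nat.
Hypothesis N_range : (n <= 2 ^ L <= 2 * n)%N.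

Definition table (i j k : nat) (s : state R) : Prop :=
  forall t, (t < n * n)%N -> is_min (candidate G L i j k (t %/ n) (t %% n)) (reals s (7 + j)%N t).

Lemma runs_oracle i j k s0 : (i < L)%N -> (j < 2)%N -> has_input G s0 ->
  ints s0 8 0 = (2 ^ L)%N -> ints s0 9 0 = (2 ^ i)%N -> reals s0 4 0 = threshold G k ->
  runs (Query (build j)) s0 1 1 (fun s => forall y x, (y < n)%N -> (x < 2 * n)%N ->
    reals s 2 (y * (2 * n) + x) =
    enc (dist (reduced G (2 ^ L) (2 ^ i) j (threshold G k)) y x)).
Proof.
move=> iL j2 [hi hr] s8 s9 s4; set H := reduced _ _ _ _ _.
apply: (runs_weaken (T := 1) (q := 1) (Post := fun s => forall k, (k < size (APSD H))%N ->
  reals s 2 k = nth 0 (APSD H) k)) => //; last first.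
  move=> s _ ans y x yn xn; rewrite ans.
    by rewrite -[(2 * n)%N]/(nv H) nth_APSD //; exact: leq_trans yn (leq_pmull _ _).
  rewrite /APSD size_allpairs size_iota -[nv H]/(2 * n)%N; nia.
apply: (runs_query (T := m * 11 + 6)); last first.
  by move=> t tT; apply: P_reduced => //; exact: reducedP.
have inp : has_input G (clear_query s0).
  by split=> [a l a3|l]; [rewrite -hi //; case: a a3 => [|[|[|]]]|exact: hr].
have bN : (2 ^ i <= 2 ^ L)%N by rewrite leq_exp2l // ltnW.
(* The bound 0 on the number of calls makes the trace of the construction empty, as [Query]
   demands. *)
have [s [t [tr [ex tT tr0 _ [_ qg]]]]] :=
  @runs_build R G W (fun _ => True) m_gt0 W_large j _ _ _ (clear_query s0) inp j2 N_range bN s8 s9 s4.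
by exists s, t; case: tr tr0 ex.
Qed.

Lemma runs_update i j k s0 : (i < L)%N -> (j < 2)%N -> has_input G s0 ->
  reals s0 4 0 = threshold G k ->
  (forall y x, (y < n)%N -> (x < 2 * n)%N -> reals s0 2 (y * (2 * n) + x)%N =
    enc (dist (reduced G (2 ^ L) (2 ^ i) j (threshold G k)) y x)) ->
  table i j k s0 ->
  runs (for_loop nn (update_body j)) s0 (n * n * 4 + 3) 0 (table i j k.+1).
Proof.
move=> iL j2 inp s4 ans tab; have n2 := nv_ge2 m_gt0.
(* Entries below [t] already account for class [k]; the others still cover the smaller class indices
   only. *)
pose I t (s : state R) := forall t', (t' < n * n)%N ->
  is_min (candidate G L i j (if (t' < t)%N then k.+1 else k) (t' %/ n) (t' %% n)) (reals s (7 + j)%N t').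
apply: (runs_weaken (T := n * n * 4 + 3) (q := n * n * 0) (Post := I (n * n)%N)) => //.
- apply: runs_for => //; first lia.
  + move=> s [fi _]; have sn : ints s 0 0 = n by rewrite fi // (input_nv inp).
    by evalw sn.
  + move=> t s tn [fi fr] st It.
    have sn : ints s 0 0 = n by rewrite fi // (input_nv inp).
    have rmods_j a : a != (7 + j)%N -> a \notin rmods (for_loop nn (update_body j)).
      by rewrite /= inE.
    have s_4 : reals s 4 0 = threshold G k by rewrite fr // rmods_j //; lia.
    have s_2 x : reals s 2 x = reals s0 2 x by rewrite fr // rmods_j //; lia.
    have yn : (t %/ n < n)%N by rewrite ltn_divLR //; lia.
    have zn : (t %% n < n)%N by rewrite ltn_mod; lia.
    have rn : (t %/ n * (2 * n) <= 2 * (n * n))%N by nia.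
    have := ans _ _ yn (leq_trans zn (leq_pmull n (isT : 0 < 2)%N)).
    have := ans _ (n + t %% n)%N yn; rewrite {1}mul2n -addnn ltn_add2l => /(_ zn).
    have N_le := andP N_range.
    have := is_min_candidateS (proj1 N_le) iL j2 yn zn (_ : is_min (candidate G L i j k _ _) (reals s (7 + j)%N t)).
    set D := enc _; set d := enc _ => step far near.
    clearbody D d.
    have [y Ey] : exists y, (t %/ n)%N = y by exists (t %/ n)%N.
    have [z Ez] : exists z, (t %% n)%N = z by exists (t %% n)%N.
    have [r Er] : exists r, (y * (2 * n))%N = r by exists (y * (2 * n))%N.
    rewrite Ey Ez Er in yn zn rn far near; rewrite -s_2 in far; rewrite -s_2 in near.
    pose E := (st, sn, s_4, Ey, Ez, Er, far, near).
    have at_t : is_min (candidate G L i j k (t %/ n) (t %% n)) (reals s (7 + j)%N t).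
      by have := It t tn; rewrite ltnn.
    have /= {at_t} := step at_t; set ok := _ && improves _ _ => step'.
    apply: runs_wp; refine (wp_if (v := ok) _ _); first by evalw E.
    have It' t' : (t' < n * n)%N -> (t' == t) = false ->
        is_min (candidate G L i j (if (t' < t.+1)%N then k.+1 else k) (t' %/ n) (t' %% n))
          (reals s (7 + j)%N t').
      by move=> t'n neq; rewrite ltnS leq_eqVlt neq /=; exact: It.
    case: ok step' => step'; last first.
      move=> t' t'n; have [->|/negPf neq] := eqVneq t' t; last exact: It'.
      by rewrite ltnSn.
    wp_put E => t' t'n; rewrite /upd /= eqxx /=.
    by have [->|/negPf neq] := eqVneq t' t; [rewrite ltnSn|exact: It'].
- by rewrite muln0.
- by move=> s _ It t tn; have := It t tn; rewrite tn.
Qed.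

Lemma runs_round i j k s0 : (i < L)%N -> (j < 2)%N -> has_input G s0 ->
  ints s0 8 0 = (2 ^ L)%N -> ints s0 9 0 = (2 ^ i)%N -> reals s0 4 0 = threshold G k ->
  table i j k s0 ->
  runs (round j) s0 (n * n * 4 + 4) 1 (table i j k.+1).
Proof.
move=> iL j2 inp s8 s9 s4 tab.
rewrite -[1%N]addn0 -[(n * n * 4 + 4)%N]/(n * n * 4 + (1 + 3))%N addnCA; apply: runs_seq.
apply: runs_weaken (runs_oracle iL j2 inp s8 s9 s4) (leqnn _) (leqnn _) _ => s fr ans.
apply: runs_update => //.
- exact: has_input_framed fr inp _ _.
- by case: fr => _ ->.
- move=> t tn; case: fr => _ ->; first exact: tab.
  by [].
Qed.

Lemma runs_clear i s0 : has_input G s0 ->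
  runs (for_loop nn clear_body) s0 (n * n * 4 + 3) 0 (fun s => table i 0 0 s /\ table i 1 0 s).
Proof.
move=> inp; have n2 := nv_ge2 m_gt0.
apply: (runs_weaken (T := n * n * 4 + 3) (q := n * n * 0) (Post := fun s => forall t,
  (t < n * n)%N -> reals s 7 t = -1 /\ reals s 8 t = -1)) => //.
- apply: (runs_for (I := fun i s => forall t, (t < i)%N -> reals s 7 t = -1 /\ reals s 8 t = -1)) => //.
  + by lia.
  + move=> s [fi _]; have sn : ints s 0 0 = n by rewrite fi // (input_nv inp).
    by evalw sn.
  + move=> t s tn _ st It; apply: runs_wp; wp_split; wp_put st; wp_put st => t' t'n.
    rewrite /upd /=; have [_|neq] := eqVneq t' t; first by rewrite mulr0n mulr1n sub0r.
    by apply: It; lia.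
- by rewrite muln0.
(* With no class treated there is no candidate, so -1 is the correct entry. *)
- move=> s _ Is; split=> t /Is[E7 E8]; split; [by left| |by left|];
    by move=> x [k [u [p []]]].
Qed.

Notation K := (Num.truncn (log2 (edge_ratio G))).+1.

Lemma runs_classes i s0 : (i < L)%N -> has_input G s0 ->
  ints s0 8 0 = (2 ^ L)%N -> ints s0 9 0 = (2 ^ i)%N ->
  reals s0 6 0 = max_weight G -> reals s0 5 0 = min_weight G ->
  table i 0 0 s0 -> table i 1 0 s0 ->
  runs class_loop s0 (1 + (K * (n * n * 8 + 10) + 2)) (K * 2)
    (fun s => table i 0 K s /\ table i 1 K s).
Proof.
move=> iL inp s8 s9 s6 s5 t0 t1; have [thK thk] := threshold_classes m_gt0.
have two0 : (2%:R == 0 :> R) = false by rewrite pnatr_eq0.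
apply: runs_wp_seq; wp_put s6.
pose I k (s : state R) := [/\ reals s 4 0 = threshold G k, table i 0 k s & table i 1 k s].
apply: (runs_weaken (T := K * (n * n * 8 + 9).+1 + 2) (q := K * 2) (Post := I K)) => //; last first.
- by move=> s _ [].
- by rewrite -[(_ + 9).+1]addnS.
apply: runs_while => [k s kK fr [s4 tb0 tb1]|s fr [s4 tb0 tb1]|]; last first.
- by split=> //; rewrite /= /upd /= /threshold expr0 divr1.
- have s_5 : reals s 5 0 = min_weight G by case: fr => _ ->.
  by evalw (s4, s_5); rewrite thK.
have s_5 : reals s 5 0 = min_weight G by case: fr => _ ->.
split; first by evalw (s4, s_5); rewrite ltNge thk.
have inps : has_input G s.
  have inp1 : has_input G (State (ints s0) (upd (reals s0) 4 0 (max_weight G))).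
    by case: inp => hi hr; split=> // l; rewrite -hr.
  exact: has_input_framed fr inp1 _ _.
have s_8 : ints s 8 0 = (2 ^ L)%N by case: fr => -> //.
have s_9 : ints s 9 0 = (2 ^ i)%N by case: fr => -> //.
(* The rounds for the two bit values write to different tables, so the frame of each preserves the
   other's table. *)
apply: (runs_weaken (T := n * n * 4 + 4 + (n * n * 4 + 4 + 1)) (q := 1 + (1 + 0))
  (Post := I k.+1)) => //; last by lia.
apply: runs_seq; apply: runs_weaken (runs_round iL _ inps s_8 s_9 s4 tb0) (leqnn _) (leqnn _) _ => //.
move=> s' fr' tb0'; apply: runs_seq.
have inps' : has_input G s' by exact: has_input_framed fr' inps _ _.
apply: runs_weaken (runs_round (i := i) (k := k) iL _ inps' _ _ _ _) (leqnn _) (leqnn _) _ => //.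
- by case: fr' => ->.
- by case: fr' => ->.
- by case: fr' => _ ->.
- by move=> t tn; case: fr' => _ -> //; exact: tb1.
move=> s'' fr'' tb1''; apply: runs_wp.
have s''4 : reals s'' 4 0 = threshold G k by case: fr'' => _ -> //; case: fr' => _ ->.
wp_put (s''4, two0); split.
- by rewrite /= /upd /= thresholdS.
- by move=> t tn; rewrite /= /upd /=; case: fr'' => _ -> //; exact: tb0'.
- by move=> t tn; rewrite /= /upd /=; exact: tb1''.
Qed.

Lemma runs_combine i s0 : has_input G s0 -> table i 0 K s0 -> table i 1 K s0 ->
  is_min (pair_candidate G L K i 0) (reals s0 9 0) ->
  runs (for_loop nn combine_body) s0 (n * n * 4 + 3) 0
    (fun s => is_min (pair_candidate G L K i (n * n)) (reals s 9 0)).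
Proof.
move=> inp t0 t1 b0; have n2 := nv_ge2 m_gt0.
apply: (runs_weaken (T := n * n * 4 + 3) (q := n * n * 0)
  (Post := fun s => is_min (pair_candidate G L K i (n * n)) (reals s 9 0))) => //.
- apply: (runs_for (I := fun t s => is_min (pair_candidate G L K i t) (reals s 9 0))) => //.
  + by lia.
  + move=> s [fi _]; have sn : ints s 0 0 = n by rewrite fi // (input_nv inp).
    by evalw sn.
  + move=> t s tn [_ fr] st bmin.
    have s_7 : reals s 7 t = reals s0 7 t by rewrite fr.
    have s_8 : reals s 8 t = reals s0 8 t by rewrite fr.
    have := is_min_pairS tn (t0 t tn) (t1 t tn) bmin; rewrite -[(7 + 0)%N]/7%N -[(7 + 1)%N]/8%N.
    rewrite -s_7 -s_8; set ok := _ && _ => step.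
    apply: runs_wp; refine (wp_if (v := ok) _ _); first by evalw st.
    by case: ok step => step //; wp_put st.
- by rewrite muln0.
Qed.

Lemma runs_bit i s0 : (i < L)%N -> has_input G s0 ->
  ints s0 8 0 = (2 ^ L)%N -> ints s0 9 0 = (2 ^ i)%N ->
  reals s0 6 0 = max_weight G -> reals s0 5 0 = min_weight G ->
  is_min (pair_candidate G L K i 0) (reals s0 9 0) ->
  runs bit_body s0 (n * n * 4 + 3 + (1 + (K * (n * n * 8 + 10) + 2) + (n * n * 4 + 3 + 1))) (K * 2)
    (fun s => ints s 9 0 = (2 ^ i.+1)%N /\ is_min (pair_candidate G L K i.+1 0) (reals s 9 0)).
Proof.
move=> iL inp s8 s9 s6 s5 bmin.
apply: (runs_seq (q1 := 0) (q2 := K * 2)); apply: runs_weaken (runs_clear i inp) (leqnn _) (leqnn _) _ => s1 fr1 [t0 t1].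
have inp1 : has_input G s1 by exact: has_input_framed fr1 inp _ _.
rewrite -[(K * 2)%N]addn0; apply: runs_seq.
apply: runs_weaken (runs_classes iL inp1 _ _ _ _ t0 t1) (leqnn _) (leqnn _) _.
- by case: fr1 => ->.
- by case: fr1 => ->.
- by case: fr1 => _ ->.
- by case: fr1 => _ ->.
move=> s2 fr2 [t0' t1'].
have inp2 : has_input G s2 by exact: has_input_framed fr2 inp1 _ _.
apply: (runs_seq (q1 := 0) (q2 := 0)); apply: runs_weaken (runs_combine inp2 t0' t1' _) (leqnn _) (leqnn _) _.
  by case: fr2 => _ -> //; case: fr1 => _ ->.
move=> s3 fr3 bmin3; apply: runs_wp.
have s39 : ints s3 9 0 = (2 ^ i)%N by case: fr3 => -> //; case: fr2 => -> //; case: fr1 => ->.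
have lt : (2 ^ i * 2 <= 2 ^ L)%N by rewrite -expnSr leq_exp2l.
have /andP[_ L2] := N_range.
wp_put s39; split; first by rewrite /= /upd /= expnSr.
exact: is_min_pair_next.
Qed.
End MainLoop.

(** * Assembly of the program and its total cost *)

Lemma up_log_range n : (1 < n)%N -> (n <= 2 ^ up_log 2 n <= 2 * n)%N.
Proof.
move=> n2; rewrite up_logP //=; have := up_log_gtn (isT : 1 < 2)%N n2.
have : (0 < up_log 2 n)%N by rewrite up_log_gt0.
by case: (up_log 2 n) => // L _ /=; rewrite expnS; lia.
Qed.

Lemma runs_main (R : realType) (G : wgraph R) W (P : nat * wgraph R -> Prop) s0 :
  let L := up_log 2 (nv G) in let K := (Num.truncn (log2 (edge_ratio G))).+1 in
  let nn := (nv G * nv G)%N in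
  (0 < ne G)%N -> (4 * nn + 8 * nv G + 16 <= W)%N ->
  (forall t H, (t <= ne G * 11 + 6)%N -> reduced_graph G H -> P (t, H)) ->
  has_input G s0 ->
  runs W (@APSD R) P main_cmd s0
    (ne G * 6 + 5 + (2 * L + 3 + (2 + (L * (nn * 8 + K * (nn * 8 + 10) + 11) + 2 + 1))))
    (L * (K * 2)) (fun s => reals s 3 0 = enc (mwc G)).
Proof.
move=> L K nn m0 WL HP inp.
have W16 : (16 <= W)%N by apply: leq_trans WL; rewrite leq_addl.
have n2 := nv_ge2 m0; have Nr := up_log_range n2.
have LW : (2 ^ L <= W)%N.
  by case/andP: Nr => _ /leq_trans -> //; apply: leq_trans WL; rewrite /nn; lia.
have [thK _] := threshold_classes m0.
apply: (runs_seq (q1 := 0) (q2 := L * (K * 2))).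
apply: runs_weaken (runs_scan P m0 WL inp) (leqnn _) (leqnn _) _ => s1 fr1 [s16 s15].
have inp1 : has_input G s1 by exact: has_input_framed fr1 inp _ _.
apply: (runs_seq (q1 := 0) (q2 := L * (K * 2))).
apply: runs_weaken (runs_power P m0 WL inp1) (leqnn _) (leqnn _) _ => s2 fr2 s28.
have inp2 : has_input G s2 by exact: has_input_framed fr2 inp1 _ _.
have s26 : reals s2 6 0 = max_weight G by case: fr2 => _ ->.
have s25 : reals s2 5 0 = min_weight G by case: fr2 => _ ->.
apply: runs_wp_seq; wp_split; wp_put s28; set s3 := State _ _.
have inp3 : has_input G s3.
  by case: inp2 => hi hr; split=> [a k a3|k]; [rewrite -hi //; case: a a3 => [|[|[|]]]|exact: hr].
rewrite -[(L * (K * 2))%N]addn0; apply: runs_seq.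
pose I i (s : state R) := ints s 9 0 = (2 ^ i)%N /\
  is_min (pair_candidate G L K i 0) (reals s 9 0).
apply: (runs_weaken (T := L * (nn * 4 + 3 + (1 + (K * (nn * 8 + 10) + 2) + (nn * 4 + 3 + 1))).+1 + 2)
  (q := L * (K * 2)) (Post := I L)) => //.
- apply: runs_while => [i s iL fr [s9 bmin]|s fr [s9 bmin]|].
  + have inps : has_input G s by exact: has_input_framed fr inp3 _ _.
    have s8 : ints s 8 0 = (2 ^ L)%N by case: fr => ->.
    have lt : (2 ^ i < 2 ^ L)%N by rewrite ltn_exp2l.
    split; first by evalw (s8, s9); rewrite lt.
    apply: runs_bit => //.
    * by case: fr => _ ->.
    * by case: fr => _ ->.
  + have s8 : ints s 8 0 = (2 ^ L)%N by case: fr => ->.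
    by evalw (s8, s9); rewrite ltnn.
  + split=> //; rewrite /= /upd /= mulr0n mulr1n sub0r; split; first by left.
    by move=> x [h [y [z [x0 [x1 [[//|[_ //]]]]]]]].
- by rewrite leq_add2r leq_mul2l; apply/orP; right; lia.
move=> s4 fr4 [_ bmin]; apply: runs_wp; wp_put s28; rewrite /= /upd /=.
by apply: is_min_mwc thK bmin; case/andP: Nr.
Qed.

Lemma mwc_program_correct (R : realType) (G : wgraph R) c : (3 < c)%N -> (0 < ne G)%N ->
  let L := up_log 2 (nv G) in let K := (Num.truncn (log2 (edge_ratio G))).+1 in
  exists s t tr, [/\ exec (word_bound c G) (@APSD R) mwc_program (input_state G) s t tr,
    outputs s (MWC G), (size tr <= 2 * L * K)%N,
    (forall tH, tH \in tr -> reduced_graph G tH.2 /\ (tH.1 <= 11 * ne G + 6)%N) &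
    (t <= 60 * (nv G * nv G * (L * K)))%N].
Proof.
move=> c3 m0 L K; have n2 := nv_ge2 m0; have mnn := ne_le_square G.
have WL : (4 * (nv G * nv G) + 8 * nv G + 16 <= word_bound c G)%N.
  apply: (@leq_trans ((nv G).+2 ^ 4)); last by rewrite leq_exp2l.
  (* [(n + 2) ^ 4] is at least [4 * (n + 2) ^ 2], which dominates the bound required of machine
     words. *)
  by rewrite (expnD _ 2 2); apply: (@leq_trans (4 * (nv G).+2 ^ 2)); [|apply: leq_mul]; nia.
pose P (tH : nat * wgraph R) := reduced_graph G tH.2 /\ (tH.1 <= 11 * ne G + 6)%N.
have HP t H : (t <= ne G * 11 + 6)%N -> reduced_graph G H -> P (t, H).
  by move=> tT rH; split=> //=; rewrite mulnC.
have inp : has_input G (input_state G) by [].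
have [s [t [tr [ex tT trq trP [_ out]]]]] := runs_main m0 WL HP inp.
exists s, t.+1, tr; split=> //.
- by apply: (EIf (v := true)) ex; evalw m0.
- by case.
- by rewrite (leq_trans trq) // -/L -/K; lia.
have L0 : (0 < L)%N by rewrite up_log_gt0.
have K0 : (0 < K)%N by [].
move: tT; rewrite -/L -/K; move: L K L0 K0 => L K L0 K0 {trq trP ex out}.
set N := (nv G * nv G)%N in mnn *; have N4 : (4 <= N)%N by rewrite /N; nia.
clearbody N; clear WL HP.
(* Each term of the cost is at most a multiple of [N * (L * K)], and 60 absorbs the coefficients. *)
have LK : (0 < L * K)%N by rewrite muln_gt0 L0.
have h1 : (N <= N * (L * K))%N by rewrite leq_pmulr.
have h2 : (L <= N * (L * K))%N by rewrite mulnCA leq_pmulr // muln_gt0 K0 (leq_trans _ N4).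
have h3 : (L * N <= N * (L * K))%N by rewrite mulnCA mulnA leq_pmulr.
have h4 : (L * K <= N * (L * K))%N by rewrite leq_pmull // (leq_trans _ N4).
rewrite !mulnDr; have -> : (L * (N * 8) = L * N * 8)%N by rewrite mulnA.
have -> : (L * (K * (N * 8)) = N * (L * K) * 8)%N by rewrite !mulnA (mulnC _ N) mulnA.
have -> : (L * (K * 10) = L * K * 10)%N by rewrite mulnA.
lia.
Qed.

(** * Integer and real logarithms *)

Section Logarithms.
Variable R : realType.

Lemma ln2_gt0 : 0 < ln 2 :> R.
Proof. by apply: ln_gt0; lra. Qed.

Lemma log2_ge0 (x : R) : 1 <= x -> 0 <= log2 x.
Proof. by move=> x1; apply: divr_ge0; [exact: ln_ge0|exact: ltW ln2_gt0]. Qed.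

Lemma log2M (x y : R) : 0 < x -> 0 < y -> log2 (x * y) = log2 x + log2 y.
Proof. by move=> x0 y0; rewrite /log2 lnM ?posrE // mulrDl. Qed.

Lemma log2_nat_ge1 n : (1 < n)%N -> 1 <= log2 n%:R :> R.
Proof.
move=> n2; rewrite /log2 ler_pdivlMr ?ln2_gt0 // mul1r ler_ln ?posrE ?ltr0n //; last lia.
by rewrite ler_nat.
Qed.

(** Rounding up adds at most 1, which is at most [log2 n] because [n] is at least 2. *)
Lemma up_log_le n : (1 < n)%N -> (up_log 2 n)%:R <= 2 * log2 n%:R :> R.
Proof.
move=> n2; have := log2_nat_ge1 n2; have := up_log_gtn (isT : 1 < 2)%N n2.
have : (0 < up_log 2 n)%N by rewrite up_log_gt0.
case: (up_log 2 n) => // L _ /= lt le1.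
have n0 : (0 < n)%N by lia.
suff : L%:R <= log2 n%:R :> R by rewrite -natr1; lra.
rewrite /log2 ler_pdivlMr ?ln2_gt0 // mulr_natl -lnXn // ler_ln ?posrE ?exprn_gt0 ?ltr0n //.
by rewrite -natrX ler_nat ltnW.
Qed.

Lemma truncn_log2_le (x : R) : 1 <= x -> (Num.truncn (log2 x)).+1%:R <= 1 + log2 x.
Proof. by move=> x1; have /andP[le _] := truncn_itv (log2_ge0 x1); rewrite -natr1; lra. Qed.
End Logarithms.

Lemma mwc_no_edges (R : realType) (G : wgraph R) : ne G = 0%N -> enc (mwc G) = -1.
Proof.
move=> m0; case: (enc_mwcP G) => [[c [[sz _ cc] _ _]]|[]//].
case: c sz cc => // u [//|v c] _ /= /andP[+ _].
by rewrite /adj; move: m0; rewrite /ne; case: (edges G).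
Qed.

(** Default values: the maximum weight is 0, so the ratio is 0, and [ln 0 = 0]. *)
Lemma log2_ratio_no_edges (R : realType) (G : wgraph R) :
  ne G = 0%N -> log2 (edge_ratio G) = 0.
Proof.
move=> m0; rewrite /edge_ratio /max_weight; move: m0; rewrite /ne.
by case: (edges G) => // _; rewrite big_nil mul0r /log2 ln0 // mul0r.
Qed.

Lemma log2_ratio_ge0 (R : realType) (G : wgraph R) : 0 <= log2 (edge_ratio G).
Proof.
have [m0|m0] := posnP (ne G); first by rewrite log2_ratio_no_edges.
exact/log2_ge0/edge_ratio_ge1.
Qed.

(** * The explicit bounds and the sparse reduction *)

Lemma mwc_bounds (R : realType) :
  exists (p : cmd) (K : nat), forall G : wgraph R, (0 < ne G)%N ->
   exists s t tr,
     [/\ exec (word_bound K G) (@APSD R) p (input_state G) s t tr,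
         outputs s (MWC G),
         (size tr <= 2 * up_log 2 (nv G)
                       * (Num.truncn (log2 (edge_ratio G))).+1)%N,
         (forall tH, tH \in tr ->
            reduced_graph G tH.2 /\ (tH.1 <= K * (nv G + ne G))%N) &
         t%:R <= K%:R * (nv G)%:R ^+ 2 * log2 (nv G)%:R
                      * log2 ((nv G)%:R * edge_ratio G)].
Proof.
(* 120 is 60 times the factor 2 lost in [up_log_le]; the summand 1 in the bound on the number of
   classes is absorbed by [log2 n], which is at least 1. The same constant covers [11 * m + 6] and
   the word size. *)
exists mwc_program, 120%N => G m0; have n2 := nv_ge2 m0; have r1 := edge_ratio_ge1 m0.
have [s [t [tr [ex out trq trP tT]]]] := mwc_program_correct (isT : 3 < 120)%N m0.
exists s, t, tr; split=> //.
  by move=> tH /trP[rH le]; split=> //; apply: leq_trans le _; lia.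
rewrite log2M ?ltr0n; [|lia|lra].
have := up_log_le R n2; have := truncn_log2_le r1; have := log2_nat_ge1 R n2.
move: tT; rewrite -(ler_nat R) !natrM.
set n : R := (nv G)%:R; set L : R := (up_log 2 _)%:R; set K : R := (Num.truncn _).+1%:R.
set a := log2 n; set b := log2 _ => tT a1 Kb La.
have L0 : 0 <= L by exact: ler0n.
have K0 : 0 <= K by exact: ler0n.
have LK : L * K <= 2 * a * (a + b) by apply: ler_pM => //; lra.
apply: le_trans tT _; rewrite expr2.
have -> : 120 * (n * n) * a * (a + b) = 60 * (n * n * (2 * a * (a + b))) by ring.
by rewrite ler_pM2l ?ltr0n // ler_wpM2l // mulr_ge0 ?ler0n.
Qed.

Lemma polylog_ge c n : (c <= polylog c n)%N.
Proof. by rewrite /polylog leq_pmulr // expn_gt0. Qed.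

(** Used with [N = n ^ 2], [x] one more than the rounded logarithm of [n], [l = 1 + log2] of the
    ratio, [Y] and [X] powers of [x]. Processing contributes 60 and the constructions [2 * 17],
    together 94; the oracle calls contribute [2 * c]. *)
Lemma reduction_cost (R : realType) (N x l c T X Y : R) :
  0 <= N -> 0 <= l -> 0 <= c -> 0 <= T -> 0 <= X -> x <= X -> x * Y <= X ->
  60 * N * (x * l) + 2 * (x * l) * (17 * N + c * Y * T) <=
  (94 + 2 * c) * X * l * (T + N).
Proof.
move=> N0 l0 c0 T0 X0 xX xYX.
have -> : 60 * N * (x * l) + 2 * (x * l) * (17 * N + c * Y * T) =
    (94 * N * x + 2 * c * T * (x * Y)) * l by ring.
have -> : (94 + 2 * c) * X * l * (T + N) = ((94 + 2 * c) * (T + N) * X) * l by ring.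
apply: ler_wpM2r => //; apply: (@le_trans _ _ ((94 * N + 2 * c * T) * X)).
  rewrite [leRHS]mulrDl; apply: lerD; apply: ler_wpM2l => //.
    by rewrite mulr_ge0 // ler0n.
  by rewrite !mulr_ge0 // ler0n.
apply: ler_wpM2r => //.
have : 0 <= c * N by exact: mulr_ge0.
by rewrite mulrDl !mulrDr; lra.
Qed.

Lemma mwc_sparse_reduction (R : realType) :
  sparse_reduction (fun _ n => n%:R ^+ 2) (@MWC R) (@APSD R).
Proof.
have linear a b : (b <= a -> 0 < a -> 11 * b + 6 <= 17 * a)%N by lia.
(* The value 4 provides large enough words, leaves room for doubling the graph, and bounds the
   number of calls, at most [2 * x * l]. *)
exists mwc_program, 4%N => T [T1 Tpoly].
(* In [polylog] the constant is both coefficient and exponent: [94 + 2 * c'] is the coefficient from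
   [reduction_cost], and exceeding [c'] it leaves room for the extra factor [x]. *)
have [c' Tc'] := Tpoly 4%N; exists (94 + 2 * c')%N => G; set C := (94 + 2 * c')%N.
have cC : (c' < C)%N by rewrite /C; lia.
have l0 := log2_ratio_ge0 G.
(* Without edges the program writes -1 in constant time, which [T >= 1] pays for. *)
have [m0|m0] := posnP (ne G).
  exists (State (ints (input_state G)) (upd (reals (input_state G)) 3 0 (-1))), 2%N, [::].
  rewrite log2_ratio_no_edges // addr0 mulr1; split=> //.
  - apply: (EIf (v := false)); first by rewrite /= !wordE /= ?m0 // (leq_trans _ (leq_pexp2l _ (isT : 1 <= 4)%N)).
    apply: ERPut; rewrite /= ?wordE //=; by rewrite mulr0n mulr1n sub0r.
  - by case=> // _; rewrite /= mwc_no_edges.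
  - rewrite big_nil addr0 ?mulr1 -[leLHS]mulr1; apply: ler_pM => //.
      by rewrite ler_nat (leq_trans _ (polylog_ge _ _)).
    by apply: le_trans (T1 (ne G) (nv G)) _; rewrite lerDl exprn_ge0.
have n2 := nv_ge2 m0; have r1 := edge_ratio_ge1 m0; have mnn := ne_le_square G.
have nn1 : (0 < nv G * nv G)%N by rewrite muln_gt0 (ltnW n2).
have [s [t [tr [ex out trq trP tT]]]] := mwc_program_correct (isT : 3 < 4)%N m0.
set L := up_log 2 (nv G) in trq tT; set K := (Num.truncn _).+1 in trq tT.
have Kl : K%:R <= 1 + log2 (edge_ratio G) := truncn_log2_le r1.
set l := 1 + log2 _ in Kl *.
have l1 : 1 <= l by rewrite lerDl.
pose x : R := L.+1%:R; have x1 : 1 <= x by rewrite ler1n.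
have poly c : (polylog c (nv G))%:R = c%:R * x ^+ c by rewrite /polylog natrM natrX.
have Lx : L%:R <= x by rewrite ler_nat.
have LKx : (L * K)%:R <= x * l by rewrite natrM ler_pM ?ler0n.
have small tH : tH \in tr -> (nv tH.2 <= polylog 4 (nv G) * nv G)%N /\
    (ne tH.2 <= polylog 4 (nv G) * ne G)%N.
  move=> /trP[[-> le _ _] _]; have p2 : (2 <= polylog 4 (nv G))%N.
    exact: leq_trans (polylog_ge _ _).
  by split; [|apply: leq_trans le _]; rewrite leq_mul2r p2 orbT.
have trl : (size tr)%:R <= 2 * (x * l).
  apply: (@le_trans _ _ (2 * L * K)%:R); first by rewrite ler_nat.
  by rewrite -mulnA natrM ler_pM2l ?ltr0n.
exists s, t, tr; split=> //.
  apply: le_trans trl _; rewrite poly mulrA ler_pM2r; last lra.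
  apply: ler_pM; [exact: ler0n|exact: ler0n|by rewrite ler_nat|].
  by rewrite -{1}[x]expr1 ler_weXn2l.
set Tm := T (ne G) (nv G); set N := (nv G)%:R ^+ 2.
have Tm1 : 1 <= Tm := T1 _ _.
have N0 : 0 <= N by rewrite exprn_ge0 ?ler0n.
have tle : t%:R <= 60 * N * (x * l).
  apply: (@le_trans _ _ (60 * (nv G * nv G * (L * K)))%:R); first by rewrite ler_nat.
  rewrite !natrM -expr2 mulrA ler_wpM2l ?mulr_ge0 ?ler0n //.
  by rewrite -natrM.
have sumle : \sum_(tH <- tr) (tH.1%:R + T (ne tH.2) (nv tH.2)) <=
    2 * (x * l) * (17 * N + c'%:R * x ^+ c' * Tm).
  apply: (@le_trans _ _ (\sum_(tH <- tr) (17 * N + c'%:R * x ^+ c' * Tm))).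
    rewrite big_seq [leRHS]big_seq; apply: ler_sum => tH tHtr; apply: lerD; last first.
      by rewrite -poly; have [n_le m_le] := small tH tHtr; exact: Tc'.
    have [_ le] := trP tH tHtr; rewrite /N -natrX -natrM ler_nat; apply: leq_trans le _.
    by rewrite -mulnn; exact: linear.
  rewrite big_const_seq count_predT iter_addr addr0 -[leLHS]mulr_natl.
  by rewrite ler_wpM2r // addr_ge0 ?mulr_ge0 ?exprn_ge0 ?ler0n //; lra.
have xC : x <= x ^+ C by rewrite -{1}[x]expr1 ler_weXn2l.
have xc : x * x ^+ c' <= x ^+ C by rewrite -exprS ler_weXn2l.
have c0 : 0 <= c'%:R :> R by rewrite ler0n.
apply: le_trans (lerD tle sumle) _; rewrite poly natrD natrM.
by apply: reduction_cost => //; lra.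
Qed.

Theorem theorem1 (R : realType) :
  (exists (p : cmd) (K : nat), forall G : wgraph R, (0 < ne G)%N ->
   exists s t tr,
     [/\ exec (word_bound K G) (@APSD R) p (input_state G) s t tr,
         outputs s (MWC G),
         (size tr <= 2 * up_log 2 (nv G)
                       * (Num.truncn (log2 (edge_ratio G))).+1)%N,
         (forall tH, tH \in tr ->
            reduced_graph G tH.2 /\ (tH.1 <= K * (nv G + ne G))%N) &
         t%:R <= K%:R * (nv G)%:R ^+ 2 * log2 (nv G)%:R
                      * log2 ((nv G)%:R * edge_ratio G)])
  /\ sparse_reduction (fun _ n => n%:R ^+ 2) (@MWC R) (@APSD R).
Proof. by split; [exact: mwc_bounds|exact: mwc_sparse_reduction]. Qed.
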